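(* Let $1,2\in I$ be two distinct indices, let $\Lambda\in P^+$, and suppose that $a_{12}\ne 0$ and $\beta=2\alpha_1+\alpha_2$. Put $l_1=\langle\Lambda,h_1\rangle$ and $l_2=\langle\Lambda,h_2\rangle$. Then the following set (with $k_1,k_2,k_3\in\mathbb N$) $$\{\psi_{1}\psi_{2}\psi_{1}x_{1}^{k_{1}}x_{2}^{k_{2}}x_{3}^{k_{3}}e(1,2,1)\mid k_{1}<l_{1},\ k_{2}<l_{2},\ k_{3}<l_{1}\}\ \cup\ \{x_{1}^{k_{1}}x_{2}^{k_{2}}x_{3}^{k_{3}}e(1,2,1)\mid k_{1}<l_{1},\ k_{2}<l_{2}-a_{21},\ k_{3}<l_{1}-a_{12}-2\}$$ forms a $K$-basis of $e(1,2,1)\mathcal R^\Lambda(\beta)e(1,2,1)$.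
   Context: Setting. $A=(a_{ij})_{i,j\in I}$ is a symmetrizable generalized Cartan matrix and $d_i\in\mathbb{Z}_{>0}$ ($i\in I$) are such that $(d_ia_{ij})$ is symmetric. $(P,\Pi,\Pi^\vee)$ is a realization of $A$: $P$ is a free abelian group, $\Pi=\{\alpha_i\mid i\in I\}\subset P$ and $\Pi^\vee=\{h_i\mid i\in I\}\subset \mathrm{Hom}_{\mathbb Z}(P,\mathbb Z)$ are linearly independent sets and $\langle\alpha_j,h_i\rangle=a_{ij}$. There is a symmetric bilinear pairing $(-|-)$ on $P$ with $(\alpha_j|\alpha_i)=d_ia_{ij}$ and $(\Lambda|\alpha_i)=d_i\langle\Lambda,h_i\rangle$ for $\Lambda\in P$. $P^+=\{\Lambda\in P\mid\langle\Lambda,h_i\rangle\ge 0\ \forall i\in I\}$, $Q^+=\bigoplus_{i\in I}\mathbb{N}\alpha_i$ with $\mathbb N=\{0,1,2,\dots\}$; for $\beta=\sum k_i\alpha_i\in Q^+$ put $|\beta|=\sum k_i$; $Q_n^+=\{\beta\in Q^+\mid|\beta|=n\}$. For $\beta\in Q^+_n$, $I^\beta=\{\nu\in I^n\mid\sum_{i=1}^n\alpha_{\nu_i}=\beta\}$. $\mathfrak S_n$ is the symmetric group (products are compositions of maps), $s_r=(r,r+1)$, and it acts on $I^n$ by $w\nu=(\nu_{w^{-1}(1)},\dots,\nu_{w^{-1}(n)})$. Let $K$ be a field. For $i,j\in I$ let $Q_{i,j}(u,v)\in K[u,v]$ with $Q_{i,i}=0$, and for $i\ne j$, $Q_{i,j}(u,v)=\sum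 t_{i,j;p,q}u^pv^q$, summed over $p,q\in\mathbb N$ with $p(\alpha_i|\alpha_i)+q(\alpha_j|\alpha_j)+2(\alpha_i|\alpha_j)=0$, where $t_{i,j;p,q}\in K$, $t_{i,j;-a_{ij},0}\in K^\times$ and $Q_{i,j}(u,v)=Q_{j,i}(v,u)$. The quiver Hecke algebra $\mathcal R(\beta)$, $\beta\in Q_n^+$, is the unital associative $K$-algebra with generators $\psi_1,\dots,\psi_{n-1},x_1,\dots,x_n,e(\nu)$ ($\nu\in I^\beta$) and relations: $e(\nu)e(\nu')=\delta_{\nu\nu'}e(\nu)$; $\sum_{\nu\in I^\beta}e(\nu)=1$; $x_re(\nu)=e(\nu)x_r$; $\psi_re(\nu)=e(s_r\nu)\psi_r$; $x_rx_s=x_sx_r$; $\psi_rx_{r+1}e(\nu)=(x_r\psi_r+\delta_{\nu_r\nu_{r+1}})e(\nu)$; $x_{r+1}\psi_re(\nu)=(\psi_rx_r+\delta_{\nu_r\nu_{r+1}})e(\nu)$; $\psi_rx_s=x_s\psi_r$ if $s\ne r,r+1$; $\psi_r\psi_s=\psi_s\psi_r$ if $|r-s|>1$; $\psi_r^2e(\nu)=Q_{\nu_r,\nu_{r+1}}(x_r,x_{r+1})e(\nu)$; $(\psi_{r+1}\psi_r\psi_{r+1}-\psi_r\psi_{r+1}\psi_r)e(\nu)=\delta_{\nu_r\nu_{r+2}}\frac{Q_{\nu_r,\nu_{r+1}}(x_r,x_{r+1})-Q_{\nu_r,\nu_{r+1}}(x_{r+2},x_{r+1})}{x_r-x_{r+2}}e(\nu)$.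 For $\Lambda\in P^+$, the cyclotomic quiver Hecke algebra $\mathcal R^\Lambda(\beta)$ is the quotient of $\mathcal R(\beta)$ by the two-sided ideal generated by $x_1^{\langle\Lambda,h_{\nu_1}\rangle}e(\nu)$, $\nu\in I^\beta$. *)

(* Defs.v *)
From HB Require Import structures.
From mathcomp Require Import all_boot all_order all_algebra.
From mathcomp Require Import perm.
From mathcomp Require Import boolp functions.
From mathcomp Require Import finmap.
From mathcomp.multinomials Require Import monalg.

Set Implicit Arguments.
Unset Strict Implicit.
Unset Printing Implicit Defensive.

Import Order.TTheory GRing.Theory Num.Theory.
Local Open Scope ring_scope.
Local Open Scope quotient_scope.

Section Bases.
Variables (R : pzRingType) (V : lmodType R) (T : eqType).

Definition free_family (f : T -> V) : Prop :=
  forall (s : seq T) (c : T -> R),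
    uniq s -> \sum_(t <- s) c t *: f t = 0 -> forall t, t \in s -> c t = 0.

Definition basis_family (W : V -> Prop) (f : T -> V) : Prop :=
  [/\ forall t, W (f t),
      free_family f &
      forall v, W v -> exists (s : seq T) (c : T -> R),
        v = \sum_(t <- s) c t *: f t].

End Bases.

Definition free_abelian (P : zmodType) : Prop :=
  exists (J : choiceType) (b : J -> zmodule P), basis_family (fun=> True) b.

Section RingQuotient.
Variables (A : pzRingType) (S : A -> Prop).

Inductive ideal_gen : A -> Prop :=
| ideal_in a : S a -> ideal_gen a
| ideal_0 : ideal_gen 0
| ideal_add a b : ideal_gen a -> ideal_gen b -> ideal_gen (a + b)
| ideal_mull a b : ideal_gen b -> ideal_gen (a * b)
| ideal_mulr a b : ideal_gen a -> ideal_gen (a * b).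

Lemma ideal_opp a : ideal_gen a -> ideal_gen (- a).
Proof. by rewrite -mulN1r; apply: ideal_mull. Qed.

Definition ideal_eqv (a b : A) : bool := `[< ideal_gen (a - b) >].

Lemma ideal_eqv_equiv : equiv_class_of ideal_eqv.
Proof.
split=> [a|a b|b a c].
- by apply/asboolP; rewrite subrr; apply: ideal_0.
- by apply/asboolP/asboolP => /ideal_opp; rewrite opprB.
- move=> /asboolP ab /asboolP bc; apply/asboolP.
  by rewrite -(subrKA b); apply: ideal_add.
Qed.

Canonical ideal_equiv := EquivRelPack ideal_eqv_equiv.

Definition ring_quot0 : Type := {eq_quot ideal_equiv}.

HB.instance Definition _ := Choice.on ring_quot0.
HB.instance Definition _ : EqQuotient A ideal_equiv ring_quot0 :=
  EqQuotient.on ring_quot0.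

Definition quot0_pi (a : A) : ring_quot0 := \pi_ring_quot0 a.

Lemma quot0_piE a b : quot0_pi a = quot0_pi b <-> ideal_gen (a - b).
Proof.
split=> [/eqP|ab]; first by rewrite /quot0_pi piE => /asboolP.
by apply/eqP; rewrite /quot0_pi piE; apply/asboolP.
Qed.

Let lift0 : ring_quot0 := quot0_pi 0.
Let lift1 : ring_quot0 := quot0_pi 1.
Let liftN (x : ring_quot0) : ring_quot0 := quot0_pi (- repr x).
Let liftD (x y : ring_quot0) : ring_quot0 := quot0_pi (repr x + repr y).
Let liftM (x y : ring_quot0) : ring_quot0 := quot0_pi (repr x * repr y).

Let piK (x : ring_quot0) : quot0_pi (repr x) = x.
Proof. exact: reprK. Qed.

Let repr_pi a : ideal_gen (repr (quot0_pi a) - a).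
Proof. by apply/quot0_piE; rewrite piK. Qed.

Let piN a : liftN (quot0_pi a) = quot0_pi (- a).
Proof.
by apply/quot0_piE; rewrite -opprD; apply: ideal_opp.
Qed.

Let piD a b : liftD (quot0_pi a) (quot0_pi b) = quot0_pi (a + b).
Proof.
apply/quot0_piE; rewrite opprD addrACA.
exact: ideal_add.
Qed.

Let piM a b : liftM (quot0_pi a) (quot0_pi b) = quot0_pi (a * b).
Proof.
apply/quot0_piE.
rewrite -(subrKA (repr (quot0_pi a) * b)) -mulrBr -mulrBl.
by apply: ideal_add; [apply: ideal_mull | apply: ideal_mulr].
Qed.

Let quotW (Pr : ring_quot0 -> Prop) :
  (forall a, Pr (quot0_pi a)) -> forall x, Pr x.
Proof. by move=> h x; rewrite -(piK x). Qed.

Let quot_addA : associative liftD.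
Proof.
elim/quotW=> a; elim/quotW=> b; elim/quotW=> c.
by rewrite !piD addrA.
Qed.
Let quot_addC : commutative liftD.
Proof. by elim/quotW=> a; elim/quotW=> b; rewrite !piD addrC. Qed.
Let quot_add0 : left_id lift0 liftD.
Proof. by elim/quotW=> a; rewrite piD add0r. Qed.
Let quot_addN : left_inverse lift0 liftN liftD.
Proof. by elim/quotW=> a; rewrite piN piD addNr. Qed.

HB.instance Definition _ :=
  GRing.isZmodule.Build ring_quot0 quot_addA quot_addC quot_add0 quot_addN.

Let quot_mulA : associative liftM.
Proof.
elim/quotW=> a; elim/quotW=> b; elim/quotW=> c.
by rewrite !piM mulrA.
Qed.
Let quot_mul1 : left_id lift1 liftM.
Proof. by elim/quotW=> a; rewrite piM mul1r. Qed.
Let quot_mulr1 : right_id lift1 liftM.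
Proof. by elim/quotW=> a; rewrite piM mulr1. Qed.
Let quot_mulDl : left_distributive liftM +%R.
Proof.
elim/quotW=> a; elim/quotW=> b; elim/quotW=> c.
by rewrite /GRing.add /= !(piM, piD) mulrDl.
Qed.
Let quot_mulDr : right_distributive liftM +%R.
Proof.
elim/quotW=> a; elim/quotW=> b; elim/quotW=> c.
by rewrite /GRing.add /= !(piM, piD) mulrDr.
Qed.

HB.instance Definition _ := GRing.Zmodule_isPzRing.Build ring_quot0
  quot_mulA quot_mul1 quot_mulr1 quot_mulDl quot_mulDr.

Let quot0_pi_zmod : zmod_morphism quot0_pi.
Proof. by move=> a b; rewrite /GRing.add /GRing.opp /= piN piD. Qed.
HB.instance Definition _ :=
  GRing.isZmodMorphism.Build A ring_quot0 quot0_pi quot0_pi_zmod.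

Let quot0_pi_monoid : monoid_morphism quot0_pi.
Proof. by split=> // a b; rewrite [RHS]/GRing.mul /= piM. Qed.
HB.instance Definition _ :=
  GRing.isMonoidMorphism.Build A ring_quot0 quot0_pi quot0_pi_monoid.

(** The quotient ring and its projection are locked: letting unification unfold
    them is prohibitively slow. *)
Fact ring_quot_key : unit. Proof. by []. Qed.

Definition ring_quot : pzRingType :=
  @locked_with ring_quot_key pzRingType ring_quot0.

Definition quot_pi : {rmorphism A -> ring_quot} :=
  match ring_quot_key as k
    return {rmorphism A -> @locked_with k pzRingType ring_quot0}
  with tt => quot0_pi end.

Lemma quot_piE a b : quot_pi a = quot_pi b <-> ideal_gen (a - b).
Proof.
by rewrite /quot_pi /ring_quot; case: ring_quot_key; apply: quot0_piE.
Qed.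

Lemma quot_pi_eq0 a : quot_pi a = 0 <-> ideal_gen a.
Proof. by rewrite -(raddf0 quot_pi) quot_piE subr0. Qed.

Lemma quot_pi_surj (x : ring_quot) : exists a, x = quot_pi a.
Proof.
move: x; rewrite /quot_pi /ring_quot; case: ring_quot_key => x.
by exists (repr (x : ring_quot0)); apply/esym/piK.
Qed.

End RingQuotient.

Section ScaleVia.
Variables (K A : pzRingType) (f : {rmorphism K -> A}).

Definition scale_via (c : K) (y : A) : A := f c * y.

Lemma scale_viaA c d y : scale_via c (scale_via d y) = scale_via (c * d) y.
Proof. by rewrite /scale_via mulrA rmorphM. Qed.
Lemma scale_via1 : left_id 1 scale_via.
Proof. by move=> y; rewrite /scale_via rmorph1 mul1r. Qed.
Lemma scale_viaDr : right_distributive scale_via +%R.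
Proof. by move=> c y z; rewrite /scale_via mulrDr. Qed.
Lemma scale_viaDl y : {morph scale_via^~ y : c d / c + d}.
Proof. by move=> c d; rewrite /scale_via rmorphD mulrDl. Qed.

End ScaleVia.

Lemma malg_scalerAr (K : comNzRingType) (M : monomType) (c : K)
    (x y : {malg K[M]}) : c *: (x * y) = x * (c *: y).
Proof.
rewrite [in RHS](malgMEw (fsubset_refl _) (msuppZ_le c y)) malgME scaler_sumr.
apply: eq_bigr => k _; rewrite scaler_sumr; apply: eq_bigr => l _.
apply/malgP => m; rewrite (mcoeffZ c y l) mulrCA.
by rewrite [LHS]mcoeffZ !mcoeffU mulrnAr.
Qed.

Section FreeAlgebra.
Variables (K : comNzRingType) (G : choiceType).

Definition free_alg0 : Type := {malg K[{fmonom G}]}.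

HB.instance Definition _ := GRing.Lalgebra.on free_alg0.
HB.instance Definition _ := GRing.Lalgebra_isAlgebra.Build K free_alg0
  (@malg_scalerAr K {fmonom G}).

Definition free_gen0 (g : G) : free_alg0 := << fmu g >>.

(** Locked for the same reason; [free_algP] is the unlocking equation. *)
Fact free_alg_key : unit. Proof. by []. Qed.

Definition free_alg : algType K :=
  @locked_with free_alg_key (algType K) free_alg0.

Definition free_gen : G -> free_alg :=
  match free_alg_key as k return G -> @locked_with k (algType K) free_alg0
  with tt => free_gen0 end.

Lemma free_algP (Pr : forall A : algType K, (G -> A) -> Prop) :
  Pr free_alg0 free_gen0 <-> Pr free_alg free_gen.
Proof. by rewrite /free_gen /free_alg; case: free_alg_key. Qed.

End FreeAlgebra.

Record cartan_datum (I : choiceType) := CartanDatum {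
  cartan : I -> I -> int;
  symmetrizer : I -> nat;
  cartan_diag : forall i, cartan i i = 2;
  cartan_le0 : forall i j, i != j -> cartan i j <= 0;
  cartan_eq0 : forall i j, cartan i j = 0 -> cartan j i = 0;
  symmetrizer_gt0 : forall i, (0 < symmetrizer i)%N;
  symmetrizerP : forall i j,
    (symmetrizer i)%:Z * cartan i j = (symmetrizer j)%:Z * cartan j i
}.

(** The form [(-|-)] takes values in [rat]; nothing forces it to be integral
    outside the root lattice. *)
Record realization (I : choiceType) (C : cartan_datum I) := Realization {
  wlat : zmodType;
  wlat_free : free_abelian wlat;
  simple_root : I -> wlat;
  root_free : free_family (simple_root : I -> zmodule wlat);
  simple_coroot : I -> {additive wlat -> int};
  coroot_free : free_family ((fun i => simple_coroot i : wlat -> int)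
                             : I -> zmodule (wlat -> int));
  coroot_root : forall i j, simple_coroot i (simple_root j) = cartan C i j;
  form : wlat -> wlat -> rat;
  formC : forall x y, form x y = form y x;
  formD : forall x y z, form (x + y) z = form x z + form y z;
  form_root : forall i j,
    form (simple_root j) (simple_root i)
      = ((symmetrizer C i)%:Z * cartan C i j)%:~R;
  form_coroot : forall (L : wlat) i,
    form L (simple_root i) = ((symmetrizer C i)%:Z * simple_coroot i L)%:~R
}.

Definition dominant (I : choiceType) (C : cartan_datum I) (X : realization C)
  (L : wlat X) : Prop := forall i, 0 <= simple_coroot X i L.

(** In [{poly {poly K}}] the outer variable is [u] and the inner one is [v], so
    that [q`_a`_b] is the coefficient of [u^a v^b] and [swapXY] exchanges the
    two variables. *)
Record QH_param (I : choiceType) (C : cartan_datum I) (X : realization C)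
    (K : fieldType) (Q : I -> I -> {poly {poly K}}) : Prop := {
  QH_diag : forall i, Q i i = 0;
  QH_homog : forall i j (p q : nat), i != j -> (Q i j)`_p`_q != 0 ->
    p%:R * form (simple_root X i) (simple_root X i)
      + q%:R * form (simple_root X j) (simple_root X j)
      + 2%:R * form (simple_root X i) (simple_root X j) = 0;
  QH_lead : forall i j, i != j -> (Q i j)`_(`|cartan C i j|%N)`_0 != 0;
  QH_sym : forall i j, i != j -> Q i j = swapXY (Q j i)
}.

Section Evaluation.
Variables (K : fieldType) (A : algType K) (q : {poly {poly K}}).

(** [q(a, b)], with powers of [a] written to the left of powers of [b]. *)
Definition eval2 (a b : A) : A :=
  \sum_(m < size q) \sum_(l < size q`_m) q`_m`_l *: (a ^+ m * b ^+ l).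

(** [(q(a, b) - q(c, b)) / (a - c)], computed monomial by monomial:
    [(u^m - w^m) / (u - w)] is the sum of [u^(m - 1 - k) w^k] over [k < m]. *)
Definition divdiff (a b c : A) : A :=
  \sum_(m < size q) \sum_(l < size q`_m)
    q`_m`_l *: ((\sum_(k < m) a ^+ (m.-1 - k) * c ^+ k) * b ^+ l).

Lemma divdiffP a b c : GRing.comm a c ->
  (a - c) * divdiff a b c = eval2 a b - eval2 c b.
Proof.
move=> ac; rewrite /divdiff mulr_sumr -sumrB; apply: eq_bigr => m _.
rewrite mulr_sumr -sumrB; apply: eq_bigr => l _.
by rewrite -scalerAr mulrA -subrXX_comm // mulrBl scalerBr.
Qed.

End Evaluation.

Section QuiverHecke.
Variables (I : choiceType) (C : cartan_datum I) (X : realization C).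
Variables (K : fieldType) (Q : I -> I -> {poly {poly K}}).
Variables (n : nat) (beta : wlat X).

Definition in_Ibeta (nu : n.-tuple I) : bool :=
  \sum_(k < n) simple_root X (tnth nu k) == beta.

Definition Ibeta : Type := {nu : n.-tuple I | in_Ibeta nu}.
HB.instance Definition _ := Choice.on Ibeta.

Definition color (nu : Ibeta) (k : 'I_n) : I := tnth (val nu) k.

Lemma perm_Ibeta_subproof (w : 'S_n) (nu : Ibeta) :
  in_Ibeta [tuple tnth (val nu) ((w^-1)%g k) | k < n].
Proof.
rewrite /in_Ibeta (reindex_perm w) -[X in _ == X](eqP (valP nu)); apply/eqP.
by apply: eq_bigr => k _; rewrite tnth_mktuple permK.
Qed.

Definition perm_Ibeta (w : 'S_n) (nu : Ibeta) : Ibeta :=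
  exist in_Ibeta _ (perm_Ibeta_subproof w nu).

(** All indices are shifted to start from 0: [r : 'I_n.-1] stands for the simple
    transposition exchanging the positions [pos r] and [posS r]. *)
Lemma posS_subproof (r : 'I_n.-1) : (r.+1 < n)%N.
Proof. by rewrite -ltn_predRL ltn_ord. Qed.

Definition pos (r : 'I_n.-1) : 'I_n := widen_ord (leq_pred n) r.
Definition posS (r : 'I_n.-1) : 'I_n := Ordinal (posS_subproof r).
Definition simple_perm (r : 'I_n.-1) : 'S_n := tperm (pos r) (posS r).

Definition QH_gen : Type := ('I_n.-1 + 'I_n + Ibeta)%type.
HB.instance Definition _ := Choice.on QH_gen.

Local Notation F := (free_alg K QH_gen).
Definition gen_psi (r : 'I_n.-1) : F := free_gen K (inl (inl r) : QH_gen).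
Definition gen_x (k : 'I_n) : F := free_gen K (inl (inr k) : QH_gen).
Definition gen_e (nu : Ibeta) : F := free_gen K (inr nu : QH_gen).
Local Notation psi := gen_psi.
Local Notation x := gen_x.
Local Notation e := gen_e.

Inductive QH_rel : F -> F -> Prop :=
| rel_e_e nu nu' : QH_rel (e nu * e nu') ((nu == nu')%:R * e nu)
(* [s] enumerates the set [Ibeta], which is finite because the simple roots are
   linearly independent. *)
| rel_e_sum (s : seq Ibeta) : uniq s -> (forall nu, nu \in s) ->
    QH_rel (\sum_(nu <- s) e nu) 1
| rel_x_e k nu : QH_rel (x k * e nu) (e nu * x k)
| rel_psi_e r nu :
    QH_rel (psi r * e nu) (e (perm_Ibeta (simple_perm r) nu) * psi r)
| rel_x_x k l : QH_rel (x k * x l) (x l * x k)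
| rel_psi_x r nu :
    QH_rel (psi r * x (posS r) * e nu)
           ((x (pos r) * psi r + (color nu (pos r) == color nu (posS r))%:R)
            * e nu)
| rel_x_psi r nu :
    QH_rel (x (posS r) * psi r * e nu)
           ((psi r * x (pos r) + (color nu (pos r) == color nu (posS r))%:R)
            * e nu)
| rel_psi_x_far r k : k != pos r -> k != posS r ->
    QH_rel (psi r * x k) (x k * psi r)
| rel_psi_psi_far (r s : 'I_n.-1) : (r.+1 < s)%N || (s.+1 < r)%N ->
    QH_rel (psi r * psi s) (psi s * psi r)
| rel_psi_sq r nu :
    QH_rel (psi r ^+ 2 * e nu)
           (eval2 (Q (color nu (pos r)) (color nu (posS r)))
                  (x (pos r)) (x (posS r)) * e nu)
| rel_braid (r s : 'I_n.-1) nu : s = r.+1 :> nat ->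
    QH_rel ((psi s * psi r * psi s - psi r * psi s * psi r) * e nu)
           ((color nu (pos r) == color nu (posS s))%:R
            * divdiff (Q (color nu (pos r)) (color nu (pos s)))
                      (x (pos r)) (x (pos s)) (x (posS s)) * e nu).

Definition QH_relator (z : F) : Prop := exists a b, QH_rel a b /\ z = a - b.

(** For [beta] in the positive root cone, [n] is meant to be its height; for any
    other [n] the type [Ibeta] is empty and the algebra is zero. *)
Definition quiver_hecke : Type := ring_quot QH_relator.
HB.instance Definition _ := GRing.PzRing.on quiver_hecke.

Definition QH_pi : {rmorphism F -> quiver_hecke} := quot_pi QH_relator.

(** Only a ring and a K-module structure are declared, with the lemmas making
    them a K-algebra: [algType] requires [1 != 0], which may fail here. *)
Definition QH_scalar : {rmorphism K -> quiver_hecke} := QH_pi \o in_alg F.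

HB.instance Definition _ := GRing.Zmodule_isLmodule.Build K quiver_hecke
  (scale_viaA QH_scalar) (scale_via1 QH_scalar)
  (scale_viaDr QH_scalar) (scale_viaDl QH_scalar).

Lemma QH_scaleE (c : K) (y : quiver_hecke) : c *: y = QH_scalar c * y.
Proof. by []. Qed.

Lemma QH_piZ (c : K) (a : F) : QH_pi (c *: a) = c *: QH_pi a.
Proof. by rewrite QH_scaleE -mulr_algl rmorphM. Qed.

Lemma QH_scalar_central (c : K) (y : quiver_hecke) :
  QH_scalar c * y = y * QH_scalar c.
Proof.
have [a {y}->] : exists a, y = QH_pi a := quot_pi_surj y.
have -> : QH_scalar c = QH_pi c%:A by [].
by rewrite -!rmorphM mulr_algl mulr_algr.
Qed.

Definition QH_psi r : quiver_hecke := QH_pi (psi r).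
Definition QH_x k : quiver_hecke := QH_pi (x k).
Definition QH_e nu : quiver_hecke := QH_pi (e nu).

Variable Lambda : wlat X.

Inductive cyc_gen : quiver_hecke -> Prop :=
| cyc_gen_intro nu (k : 'I_n) : k = 0%N :> nat ->
    cyc_gen (QH_x k ^+ `|simple_coroot X (color nu k) Lambda|%N * QH_e nu).

Definition cyc_quiver_hecke : Type := ring_quot cyc_gen.
HB.instance Definition _ := GRing.PzRing.on cyc_quiver_hecke.

Definition cyc_pi : {rmorphism quiver_hecke -> cyc_quiver_hecke} :=
  quot_pi cyc_gen.

Definition cyc_scalar : {rmorphism K -> cyc_quiver_hecke} :=
  cyc_pi \o QH_scalar.

HB.instance Definition _ := GRing.Zmodule_isLmodule.Build K cyc_quiver_hecke
  (scale_viaA cyc_scalar) (scale_via1 cyc_scalar)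
  (scale_viaDr cyc_scalar) (scale_viaDl cyc_scalar).

Lemma cyc_scaleE (c : K) (y : cyc_quiver_hecke) : c *: y = cyc_scalar c * y.
Proof. by []. Qed.

Lemma cyc_piZ (c : K) (a : quiver_hecke) : cyc_pi (c *: a) = c *: cyc_pi a.
Proof. by rewrite cyc_scaleE QH_scaleE rmorphM. Qed.

Lemma cyc_scalar_central (c : K) (y : cyc_quiver_hecke) :
  cyc_scalar c * y = y * cyc_scalar c.
Proof.
have [a {y}->] : exists a, y = cyc_pi a := quot_pi_surj y.
have -> : cyc_scalar c = cyc_pi (QH_scalar c) by [].
by rewrite -!rmorphM QH_scalar_central.
Qed.

Definition cyc_psi r : cyc_quiver_hecke := cyc_pi (QH_psi r).
Definition cyc_x k : cyc_quiver_hecke := cyc_pi (QH_x k).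
Definition cyc_e nu : cyc_quiver_hecke := cyc_pi (QH_e nu).

End QuiverHecke.

Section Beta121.
Variables (I : choiceType) (C : cartan_datum I) (X : realization C) (i j : I).

Lemma nu121_subproof :
  @in_Ibeta I C X 3 (simple_root X i *+ 2 + simple_root X j) [tuple i; j; i].
Proof.
by rewrite /in_Ibeta !big_ord_recl big_ord0 /= addr0 addrCA addrC mulr2n.
Qed.

Definition nu121 : Ibeta 3 (simple_root X i *+ 2 + simple_root X j) :=
  exist (@in_Ibeta I C X _ _) _ nu121_subproof.

End Beta121.

(* Main.v *)
From HB Require Import structures.
Require Import Defs.
From mathcomp Require Import all_boot all_order all_algebra.
From mathcomp Require Import perm finmap ring zify.
From mathcomp.multinomials Require Import monalg.
Set Implicit Arguments.
Unset Strict Implicit.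
Unset Printing Implicit Defensive.

Import Order.TTheory GRing.Theory Num.Theory.
Local Open Scope ring_scope.

(** Let [Q = Q_{12}], let [l], [m] be the two levels, [S = K[x1, x2, x3]],
    [e = e(121)], [tau = psi1 psi2 psi1 e], and put
    [D = (Q(x1, x2) - Q(x3, x2)) / (x1 - x3)],
    [h = (x1^l - x3^l) / (x1 - x3)].

    The left module [R(beta) e] is generated, over [S] acting on the right, by
    two elements in each of the blocks [121], [211], [112]. The defining
    relations determine the left action of the generators of [R(beta)] on these
    six elements; it is given by 2 x 2 blocks with entries in [S], built from
    [Q(x1, x2)], [Q(x3, x2)] and [D] ([Theta_x], [Theta_psi]). Conversely these
    blocks satisfy all the defining relations ([rho_rel]), hence define a
    representation of [R(beta)] on a free [S]-module of rank six. The first fact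
    shows that [e R(beta) e] consists of the elements [e f + tau g] with [f], [g]
    in [S] ([sandwich_121]); the second one tells which of them survive in the
    cyclotomic quotient.

    Indeed [e f + tau g] vanishes there exactly when [(f, g)] belongs to the
    [S]-module [rel121] generated by [(x1^l, 0)], [(0, x1^l)],
    [(x2^m Q(x1, x2), 0)], [(0, x2^m)], [(D h, h)] and [(Q(x3, x2) h, 0)]. Each
    of these generators vanishes, being obtained from the generators
    [x1^l e(121)], [x1^m e(211)], [x1^l e(112)] of the cyclotomic ideal by
    multiplication with [psi] and the [x_k] ([killed_rel121]). Nothing else
    does, because [rel121], completed by similar modules in the two other
    blocks, is stable under the representation and contains the images of these
    three generators ([cyc_mx_ideal]).

    It remains to see that the pairs that satisfy the degree bounds of the
    theorem form a complement of [rel121] in [S^2]. By homogeneity and the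
    invertibility of the extreme coefficients of [Q], the polynomial [Q(x1, x2)]
    is monic up to a scalar of degree [- a_21] in [x2], and [D h] is monic up to a
    scalar of degree [l - a_12 - 2] in [x3]. The relations thus replace the powers
    [x1^l], [x2^(m - a_21)], [x3^(l - a_12 - 2)] in the first component, and
    [x1^l], [x2^m], [x3^l] in the second one, by lower terms ([generate]). The
    reduced pairs are independent modulo [rel121] by division in one variable at
    a time ([reduced_rel121_eq0]). *)

(** * Universal properties of free algebras and of polynomial rings *)
Section FreeAlgebraUniversal.
Variables (K : fieldType) (G : choiceType).
Local Notation M := {malg K[{fmonom G}]}.

(** An element of the algebra is a combination of words, and a word is a product
    of generators. *)
Lemma malg_gen_ind (P : free_alg0 K G -> Prop) :
  (forall c, P c%:A) -> (forall g, P (free_gen0 K g)) ->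
  (forall a b, P a -> P b -> P (a + b)) ->
  (forall a b, P a -> P b -> P (a * b)) -> forall a, P a.
Proof.
move=> Pc Pg Pd Pm a.
have P0 : P 0 by rewrite -(scale0r 1); apply: Pc.
have UU c1 c2 k1 k2 : << c1 *g k1 >> * << c2 *g k2 >> = << c1 * c2 *g mmul k1
  k2 >> :> M.
  by rewrite malgM_def fgmulUU.
have Pw (s : seq G) : P (<< 1 *g FMonom s >> : M).
  elim: s => [|g s IHs].
    have -> : << 1 *g FMonom [::] >> = 1%:A :> M.
      by rewrite scale1r -fmoneE.
    exact: Pc.
  have -> : << 1 *g FMonom (g :: s) >> = << 1 *g fmu g >> * << 1 *g FMonom s >>
    :> M.
    by rewrite UU mulr1; congr (<< _ *g _ >>); rewrite /mmul /= fmmulE fmuE.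
  by apply: Pm => //; apply: Pg.
rewrite (monalgE (a : M)); elim/big_ind: _ => // w _.
have -> : << mcoeff w (a : M) *g w >> = (mcoeff w (a : M))%:A * << 1 *g w >> :>
  M.
  by rewrite -scalerAl mul1r -mul_malgC /= UU mulr1 mul1m.
by apply: Pm => //; case: w => s; apply: Pw.
Qed.

Variables (A : nzRingType) (f : {rmorphism K -> A}) (g : G -> A).
Hypothesis f_central : forall c a, f c * a = a * f c.

Definition word_prod (w : {fmonom G}) : A := \prod_(i <- fmonom_val w) g i.

Lemma word_prod_morph : monalg.mmorphism word_prod.
Proof.
split=> [v w|]; first by rewrite /word_prod fmM big_cat.
by rewrite /word_prod fm1 big_nil.
Qed.
HB.instance Definition _ :=
  monalg.isMultiplicative.Build _ _ word_prod word_prod_morph.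

Definition malg_lift : free_alg0 K G -> A := mmap f word_prod.
HB.instance Definition _ := GRing.Additive.on malg_lift.
Lemma malg_lift_monoid : monoid_morphism malg_lift.
Proof.
have [fM f1] : multiplicative malg_lift.
  by apply: commr_mmap_is_multiplicative => a v w; apply: f_central.
by split.
Qed.
HB.instance Definition _ :=
  GRing.isMonoidMorphism.Build _ _ malg_lift malg_lift_monoid.

Lemma malg_universal : exists F : {rmorphism free_alg0 K G -> A},
  (forall c, F c%:A = f c) /\ (forall i, F (free_gen0 K i) = g i).
Proof.
exists malg_lift; split=> [c|i].
  by rewrite /= /malg_lift mmapZ mmap1 mulr1.
have -> : g i = f 1 * word_prod (fmu i).
    by rewrite rmorph1 mul1r /word_prod fmU big_seq1.
  exact: mmapU.
Qed.

End FreeAlgebraUniversal.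

(** The free algebra is locked; both of its universal properties are proved for
    the unlocked algebra of words and transported by [free_algP]. *)
Lemma free_alg_ind (K : fieldType) (G : choiceType) (P : free_alg K G -> Prop) :
  (forall c, P c%:A) -> (forall g, P (free_gen K g)) ->
  (forall a b, P a -> P b -> P (a + b)) ->
  (forall a b, P a -> P b -> P (a * b)) -> forall a, P a.
Proof.
move: P; pose Pr (A : algType K) (gen : G -> A) := forall P : A -> Prop,
  (forall c, P c%:A) -> (forall g, P (gen g)) ->
  (forall a b, P a -> P b -> P (a + b)) ->
  (forall a b, P a -> P b -> P (a * b)) -> forall a, P a.
by have := proj1 (@free_algP K G Pr) (@malg_gen_ind K G).
Qed.

Lemma free_alg_universal (K : fieldType) (G : choiceType) (A : nzRingType)
    (f : {rmorphism K -> A}) (g : G -> A) :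
  (forall c a, f c * a = a * f c) ->
  exists F : {rmorphism free_alg K G -> A},
    (forall c, F c%:A = f c) /\ (forall i, F (free_gen K i) = g i).
Proof.
move=> fC.
pose Pr (B : algType K) (gen : G -> B) := exists F : {rmorphism B -> A},
    (forall c, F c%:A = f c) /\ (forall i, F (gen i) = g i).
by have := proj1 (@free_algP K G Pr) (@malg_universal K G A f g fC).
Qed.

Section PolyUniversal.
Variables (R : nzRingType) (A : pzRingType) (f : {rmorphism R -> A}) (a : A).
Hypothesis fa : forall c, f c * a = a * f c.

(** The target is only a [pzRingType], because the quiver Hecke algebra is not
    known to be nonzero; hence evaluation is built from coefficients instead of
    Horner evaluation. *)
Definition poly_lift (p : {poly R}) : A := \sum_(i < size p) f p`_i * a ^+ i.

Lemma poly_lift_widen n (p : {poly R}) : (size p <= n)%N ->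
  poly_lift p = \sum_(i < n) f p`_i * a ^+ i.
Proof.
move=> le; rewrite /poly_lift (big_ord_widen n (fun i => f p`_i * a ^+ i)) //.
rewrite big_mkcond; apply: eq_bigr => i _; case: ltnP => // h.
by rewrite nth_default // rmorph0 mul0r.
Qed.

Lemma poly_lift_zmod : zmod_morphism poly_lift.
Proof.
move=> p q; pose n := maxn (size p) (size q).
rewrite !(@poly_lift_widen n) ?leq_maxl ?leq_maxr //; last first.
  by rewrite (leq_trans (size_polyD _ _)) ?size_polyN.
by rewrite -sumrB; apply: eq_bigr => i _; rewrite coefB rmorphB mulrBl.
Qed.
HB.instance Definition _ := GRing.isZmodMorphism.Build _ _ poly_lift
  poly_lift_zmod.

Lemma poly_liftC c : poly_lift c%:P = f c.
Proof.
by rewrite (@poly_lift_widen 1) ?size_polyC_leq1 // big_ord1 coefC mulr1.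
Qed.

Lemma poly_liftMX p : poly_lift (p * 'X) = poly_lift p * a.
Proof.
rewrite (@poly_lift_widen (size p).+1); last first.
  by have [->|pn0] := eqVneq p 0; rewrite ?mul0r ?size_poly0 // size_mulX.
rewrite big_ord_recl coefMX /= rmorph0 mul0r add0r mulr_suml.
by apply: eq_bigr => i _; rewrite coefMX /= exprSr mulrA.
Qed.

Lemma poly_liftCM c p : poly_lift (c%:P * p) = f c * poly_lift p.
Proof.
rewrite (@poly_lift_widen (size p)) ?mul_polyC ?size_scale_leq // mulr_sumr.
by apply: eq_bigr => i _; rewrite coefZ rmorphM mulrA.
Qed.

Lemma poly_lift_comm p : a * poly_lift p = poly_lift p * a.
Proof.
rewrite mulr_sumr mulr_suml; apply: eq_bigr => i _.
by rewrite mulrA -fa -!mulrA -exprS -exprSr.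
Qed.

Lemma poly_lift_monoid : monoid_morphism poly_lift.
Proof.
split=> [|p q]; first by rewrite poly_liftC rmorph1.
elim/poly_ind: p q => [|p c IHp] q; first by rewrite mul0r raddf0 mul0r.
rewrite mulrDl !raddfD /= mulrDl poly_liftCM poly_liftC; congr (_ + _).
by rewrite -mulrA -commr_polyX IHp poly_liftMX poly_liftMX -mulrA
  poly_lift_comm.
Qed.
HB.instance Definition _ :=
  GRing.isMonoidMorphism.Build _ _ poly_lift poly_lift_monoid.

Lemma poly_universal : exists F : {rmorphism {poly R} -> A},
  (forall c, F c%:P = f c) /\ F 'X = a.
Proof.
exists poly_lift; split=> [c|]; first exact: poly_liftC.
by rewrite -['X]mul1r /= poly_liftMX -polyC1 poly_liftC rmorph1 mul1r.
Qed.

End PolyUniversal.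

Lemma poly_rmorph_comm (R : nzRingType) (A : pzRingType)
    (F : {rmorphism {poly R} -> A}) (b : A) :
  (forall c, F c%:P * b = b * F c%:P) -> F 'X * b = b * F 'X ->
  forall p, F p * b = b * F p.
Proof.
move=> FC FX p; elim/poly_ind: p => [|p c IHp];
  first by rewrite rmorph0 mul0r mulr0.
by rewrite rmorphD rmorphM mulrDl mulrDr FC -mulrA FX mulrA IHp mulrA.
Qed.

Section Poly3Universal.
Variables (K : fieldType) (A : pzRingType) (f : {rmorphism K -> A}).
Variables (a b c : A).
Hypothesis f_central : forall k y, f k * y = y * f k.
Hypotheses (ab : a * b = b * a) (ac : a * c = c * a) (bc : b * c = c * b).

(** Supplies the right action of [K[x1, x2, x3]] on the quiver Hecke algebra. *)
Lemma poly3_universal : exists F : {rmorphism {poly {poly {poly K}}} -> A},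
  [/\ forall k, F k%:P%:P%:P = f k,
      F 'X%:P%:P = a, F 'X%:P = b & F 'X = c].
Proof.
have [F1 [F1C F1X]] := @poly_universal _ _ f a (fun k => f_central k a).
have F1b p : F1 p * b = b * F1 p.
  by apply: poly_rmorph_comm => [k|]; rewrite ?F1C ?F1X.
have F1c p : F1 p * c = c * F1 p.
  by apply: poly_rmorph_comm => [k|]; rewrite ?F1C ?F1X.
have [F2 [F2C F2X]] := @poly_universal _ _ F1 b F1b.
have F2c p : F2 p * c = c * F2 p.
  by apply: poly_rmorph_comm => [k|]; rewrite ?F2C ?F2X.
have [F3 [F3C F3X]] := @poly_universal _ _ F2 c F2c.
by exists F3; split=> [k|||]; rewrite ?F3C ?F2C ?F1C ?F2X ?F1X.
Qed.

End Poly3Universal.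

(** * Values and divided differences of a polynomial in two variables *)
Section TwoVariables.
Variables (K : fieldType) (A : pzRingType).
Implicit Types (i : K -> A) (q : {poly {poly K}}) (a b c : A).

(** The complete homogeneous symmetric polynomial of degree [n - 1] in two
    variables, which is the quotient of [a ^+ n - c ^+ n] by [a - c]. *)
Definition hsum n a c : A := \sum_(k < n) a ^+ (n.-1 - k) * c ^+ k.

(** [eval2] and [divdiff] with scalars acting through a map [i]: the quiver Hecke
    algebra and the matrix rings used below carry no [algType K] structure. *)
Definition ev2 i q a b : A :=
  \sum_(m < size q) \sum_(l < size q`_m) i q`_m`_l * (a ^+ m * b ^+ l).

Definition dd2 i q a b c : A :=
  \sum_(m < size q) \sum_(l < size q`_m) i q`_m`_l * (hsum m a c * b ^+ l).

Lemma eq_ev2 i j q a b : i =1 j -> ev2 i q a b = ev2 j q a b.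
Proof. by move=> ij; do 2![apply: eq_bigr => ? _]; rewrite ij. Qed.

Lemma eq_dd2 i j q a b c : i =1 j -> dd2 i q a b c = dd2 j q a b c.
Proof. by move=> ij; do 2![apply: eq_bigr => ? _]; rewrite ij. Qed.

Lemma ev2_poly0 i a b : ev2 i 0 a b = 0.
Proof. by rewrite /ev2 size_poly0 big_ord0. Qed.

Lemma hsumP n a c : a * c = c * a -> (a - c) * hsum n a c = a ^+ n - c ^+ n.
Proof. by move=> ac; rewrite subrXX_comm. Qed.

Lemma dd2P i q a b c : (forall k, i k * a = a * i k) ->
    (forall k, i k * c = c * i k) -> a * c = c * a ->
  (a - c) * dd2 i q a b c = ev2 i q a b - ev2 i q c b.
Proof.
move=> ia ic ac; rewrite mulr_sumr -sumrB; apply: eq_bigr => m _.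
rewrite mulr_sumr -sumrB; apply: eq_bigr => l _.
rewrite -mulrBr -mulrBl -hsumP // !mulrA; congr (_ * _ * _).
by rewrite mulrBl mulrBr ia ic.
Qed.

Lemma hsum_sym n a c : a * c = c * a -> hsum n a c = hsum n c a.
Proof.
move=> ac; rewrite /hsum (reindex_inj rev_ord_inj); apply: eq_bigr => k _ /=.
have -> : (n.-1 - (n - k.+1) = k)%N by have := ltn_ord k; lia.
have -> : (n - k.+1 = n.-1 - k)%N by lia.
by apply: commrX; apply/commr_sym/commrX.
Qed.

Lemma dd2_sym i q a b c : a * c = c * a -> dd2 i q a b c = dd2 i q c b a.
Proof.
by move=> ac; do 2![apply: eq_bigr => ? _]; rewrite (hsum_sym _ ac).
Qed.

(** A common square range of exponents makes the two sums exchangeable, which is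
    what [ev2_swap] needs. *)
Lemma ev2_widen (i : {rmorphism K -> A}) q a b n :
    (size q <= n)%N -> (forall m, (size (q`_m)%R <= n)%N) ->
  ev2 i q a b = \sum_(m < n) \sum_(l < n) i q`_m`_l * (a ^+ m * b ^+ l).
Proof.
move=> sq sqm.
rewrite /ev2 (big_ord_widen n (fun m =>
   \sum_(l < size q`_m) i q`_m`_l * (a ^+ m * b ^+ l))) // big_mkcond.
apply: eq_bigr => m _; case: ltnP => [_|h].
  rewrite (big_ord_widen n (fun l => i q`_m`_l * (a ^+ m * b ^+ l))) //.
  rewrite big_mkcond; apply: eq_bigr => l _; case: ltnP => // h.
  by rewrite (nth_default _ h) rmorph0 mul0r.
by rewrite big1 // => l _; rewrite (nth_default _ h) coef0 rmorph0 mul0r.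
Qed.

Lemma ev2_swap (i : {rmorphism K -> A}) q a b : a * b = b * a ->
  ev2 i (swapXY q) a b = ev2 i q b a.
Proof.
move=> ab.
have [n [s1 s2 s3 s4]] : exists n, [/\ (size q <= n)%N,
    (forall m, (size (q`_m)%R <= n)%N), (size (swapXY q) <= n)%N
    & (forall m, (size ((swapXY q)`_m)%R <= n)%N)].
  have bd (p : {poly {poly K}}) : exists n, (size p <= n)%N /\ (forall m, (size
    (p`_m)%R <= n)%N).
    exists (maxn (size p) (\max_(m < size p) size (p`_m)%R)).
    split=> [|m]; first exact: leq_maxl.
    have [h|h] := ltnP m (size p); last by rewrite nth_default ?size_poly0.
    rewrite leq_max; apply/orP; right.
    exact: (leq_bigmax (Ordinal h)).
  have [[n1 [? h1]] [n2 [? h2]]] := (bd q, bd (swapXY q)).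
  exists (maxn n1 n2); split=> [|m||m].
  - by rewrite (leq_trans _ (leq_maxl _ _)).
  - by rewrite (leq_trans (h1 m)) ?leq_maxl.
  - by rewrite (leq_trans _ (leq_maxr _ _)).
  - by rewrite (leq_trans (h2 m)) ?leq_maxr.
rewrite (ev2_widen i b a s1 s2) (ev2_widen i a b s3 s4) exchange_big.
do 2![apply: eq_bigr => ? _]; rewrite coef_swapXY; congr (_ * _).
by apply: commrX; apply/commr_sym/commrX.
Qed.

End TwoVariables.

(** A relation between two rings that respects the ring operations is inherited
    by the values of a polynomial. It is used with the graph of a morphism, with
    commutation with a fixed element, and with the action of a block matrix on
    one of its rows. *)
Section RingRelation.
Variables (K : fieldType) (A B : pzRingType) (R : A -> B -> Prop).
Hypotheses (R0 : R 0 0) (R1 : R 1 1).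
Hypothesis RD : forall a a' b b', R a b -> R a' b' -> R (a + a') (b + b').
Hypothesis RM : forall a a' b b', R a b -> R a' b' -> R (a * a') (b * b').

Lemma rel_exp a b n : R a b -> R (a ^+ n) (b ^+ n).
Proof. by move=> ab; elim: n => // n IHn; rewrite !exprS; apply: RM. Qed.

Lemma rel_sum n (F : 'I_n -> A) (G : 'I_n -> B) :
  (forall k, R (F k) (G k)) -> R (\sum_k F k) (\sum_k G k).
Proof. by move=> FG; elim/big_ind2: _ => // *; apply: RD. Qed.

Variables (i : K -> A) (j : K -> B) (q : {poly {poly K}}).
Hypothesis Rij : forall k, R (i k) (j k).

Lemma rel_ev2 a a' b b' : R a b -> R a' b' -> R (ev2 i q a a') (ev2 j q b b').
Proof.
by move=> *; do 2![apply: rel_sum => ?]; do !apply: RM => //; apply: rel_exp.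
Qed.

Lemma rel_dd2 a a' a'' b b' b'' : R a b -> R a' b' -> R a'' b'' ->
  R (dd2 i q a a' a'') (dd2 j q b b' b'').
Proof.
move=> *; do 2![apply: rel_sum => ?]; do !apply: RM => //; last exact: rel_exp.
by apply: rel_sum => k; apply: RM; apply: rel_exp.
Qed.

End RingRelation.

Section EvalNatural.
Variables (K : fieldType) (q : {poly {poly K}}).

Lemma rmorph_ev2 (A B : pzRingType) (f : {rmorphism A -> B}) (i : K -> A) a b :
  f (ev2 i q a b) = ev2 (f \o i) q (f a) (f b).
Proof.
apply: (@rel_ev2 K A B (fun x y => f x = y)); rewrite ?rmorph0 ?rmorph1 //.
- by move=> ? ? ? ? <- <-; rewrite rmorphD.
- by move=> ? ? ? ? <- <-; rewrite rmorphM.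
Qed.

Lemma rmorph_dd2 (A B : pzRingType) (f : {rmorphism A -> B}) (i : K -> A) a b c
  :
  f (dd2 i q a b c) = dd2 (f \o i) q (f a) (f b) (f c).
Proof.
apply: (@rel_dd2 K A B (fun x y => f x = y)); rewrite ?rmorph0 ?rmorph1 //.
- by move=> ? ? ? ? <- <-; rewrite rmorphD.
- by move=> ? ? ? ? <- <-; rewrite rmorphM.
Qed.

Lemma eval2E (A : algType K) (a b : A) : eval2 q a b = ev2 (in_alg A) q a b.
Proof. by do 2![apply: eq_bigr => ? _]; rewrite /= mulr_algl. Qed.

Lemma divdiffE (A : algType K) (a b c : A) :
  divdiff q a b c = dd2 (in_alg A) q a b c.
Proof. by do 2![apply: eq_bigr => ? _]; rewrite /= mulr_algl. Qed.

End EvalNatural.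

(** * Functions of triangular matrices of size two *)
Section TwoByTwo.
Variable S : comNzRingType.
Implicit Types a b c d : S.

Definition mx2 a b c d : 'M[S]_2 :=
  \matrix_(s, t) if s == 0 then if t == 0 then a else b
                 else if t == 0 then c else d.

Lemma mx2P (A B : 'M[S]_2) : A 0 0 = B 0 0 -> A 0 1 = B 0 1 ->
  A 1 0 = B 1 0 -> A 1 1 = B 1 1 -> A = B.
Proof.
move=> h00 h01 h10 h11; apply/matrixP => s t.
have o2 (k : 'I_2) : k = 0 \/ k = 1.
  by case: k => [[|[|]]] // h; [left|right]; apply: val_inj.
by case: (o2 s) => ->; case: (o2 t) => ->.
Qed.

Lemma mx2_mul a b c d a' b' c' d' : mx2 a b c d * mx2 a' b' c' d' =
  mx2 (a * a' + b * c') (a * b' + b * d') (c * a' + d * c') (c * b' + d * d').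
Proof.
by apply: mx2P; rewrite !mxE !big_ord_recl big_ord0 /= !mxE /= addr0.
Qed.

Lemma mx2_add a b c d a' b' c' d' :
  mx2 a b c d + mx2 a' b' c' d' = mx2 (a + a') (b + b') (c + c') (d + d').
Proof. by apply: mx2P; rewrite !mxE. Qed.

Lemma mx2_opp a b c d : - mx2 a b c d = mx2 (- a) (- b) (- c) (- d).
Proof. by apply: mx2P; rewrite !mxE. Qed.

Lemma mx2_scalar a : a%:M = mx2 a 0 0 a.
Proof. by apply: mx2P; rewrite !mxE. Qed.

Lemma mx2_sum n (f g h k : 'I_n -> S) :
  \sum_i mx2 (f i) (g i) (h i) (k i)
    = mx2 (\sum_i f i) (\sum_i g i) (\sum_i h i) (\sum_i k i).
Proof.
by apply: mx2P; rewrite summxE !mxE /=; apply: eq_bigr => i _; rewrite !mxE.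
Qed.

(** The off-diagonal entry of a function of a triangular matrix is a divided
    difference; the next three lemmas are instances. This is how the quotient
    [(Q(x1, x2) - Q(x3, x2)) / (x1 - x3)] enters the action of [psi]. *)
Lemma mx2_exp x u z n :
  mx2 x (- u) 0 z ^+ n = mx2 (x ^+ n) (- u * hsum n x z) 0 (z ^+ n).
Proof.
elim: n => [|n IHn].
  by rewrite !expr0 /hsum big_ord0 mulr0 -mx2_scalar.
rewrite exprSr {}IHn mx2_mul !exprSr; congr mx2; try ring.
rewrite /hsum big_ord_recr /= subnn expr0 mul1r.
have -> : \sum_(i < n) x ^+ (n - i) * z ^+ i = x * \sum_(i < n) x ^+ (n.-1 - i)
  * z ^+ i.
  rewrite mulr_sumr; apply: eq_bigr => k _; rewrite mulrA -exprS.
  by congr (x ^+ _ * _); have := ltn_ord k; lia.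
have := hsumP n (mulrC x z); rewrite mulrBl => /(canRL (subrK _)).
by rewrite /hsum => ->; ring.
Qed.

Lemma ev2_triangular (K : fieldType) (i : K -> S) q x u z y :
  ev2 (fun k => (i k)%:M) q (mx2 x (- u) 0 z) y%:M
    = mx2 (ev2 i q x y) (- u * dd2 i q x y z) 0 (ev2 i q z y).
Proof.
have sum0 n : 0 = \sum_(k < n) (0 : S) by rewrite big1.
rewrite /ev2 /dd2 mulr_sumr [X in _ = mx2 _ _ X _](sum0 (size q)).
rewrite -mx2_sum; apply: eq_bigr => m _.
rewrite mulr_sumr [X in _ = mx2 _ _ X _](sum0 (size (q`_m))).
rewrite -mx2_sum; apply: eq_bigr => l _.
have -> : y%:M ^+ l = (y ^+ l)%:M :> 'M[S]_2.
  by rewrite -rmorphXn.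
rewrite mx2_exp !mx2_scalar !mx2_mul; congr mx2; ring.
Qed.

(** The two matrices have a scalar sum and a scalar product, so every symmetric
    function of them is scalar. *)
Lemma hsum_triangular x u z n :
  hsum n (mx2 x (- u) 0 z) (mx2 z u 0 x) = (hsum n x z)%:M.
Proof.
rewrite {1}/hsum; under eq_bigr => k _ do
  rewrite -[in X in _ * mx2 _ X _ _ ^+ _](opprK u) !mx2_exp mx2_mul.
rewrite mx2_sum mx2_scalar; congr mx2.
- by apply: eq_bigr => k _; ring.
- have -> : \sum_(k < n) (x ^+ (n.-1 - k) * (- - u * hsum k z x) +
     - u * hsum (n.-1 - k) x z * x ^+ k) =
     \sum_(k < n) x ^+ (n.-1 - k) * (u * hsum k z x) -
     \sum_(k < n) u * hsum (n.-1 - k) x z * x ^+ k.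
    by rewrite -sumrB; apply: eq_bigr => k _; ring.
  apply/eqP; rewrite subr_eq0; apply/eqP.
  (* The off-diagonal sum is antisymmetric under the reversal of [k]. *)
  rewrite [RHS](reindex_inj rev_ord_inj); apply: eq_bigr => k _ /=.
  have -> : (n.-1 - (n - k.+1) = k)%N by have := ltn_ord k; lia.
  have -> : (n - k.+1 = n.-1 - k)%N by lia.
  by rewrite (hsum_sym _ (mulrC z x)); ring.
- by rewrite big1 // => k _; ring.
- by rewrite (hsum_sym _ (mulrC x z)); apply: eq_bigr => k _; ring.
Qed.

Lemma dd2_triangular (K : fieldType) (i : K -> S) q x u z y :
  dd2 (fun k => (i k)%:M) q (mx2 x (- u) 0 z) y%:M (mx2 z u 0 x)
    = (dd2 i q x y z)%:M.
Proof.
rewrite /dd2 rmorph_sum; apply: eq_bigr => m _.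
rewrite rmorph_sum; apply: eq_bigr => l _.
have -> : y%:M ^+ l = (y ^+ l)%:M :> 'M[S]_2.
  by rewrite -rmorphXn.
by rewrite hsum_triangular !rmorphM.
Qed.

End TwoByTwo.

(** * Division of polynomials modulo an ideal of coefficients *)
Section TopCoefficient.
Variable R : comNzRingType.
Implicit Types p q : {poly R}.

Lemma coef_size0 p n k : (size p <= n)%N -> (n <= k)%N -> p`_k = 0.
Proof. by move=> sp nk; rewrite nth_default // (leq_trans sp). Qed.

Lemma size_mul_top p q d e : (size p <= d.+1)%N -> (size q <= e.+1)%N ->
  (size (p * q)%R <= (d + e).+1)%N.
Proof. by move=> sp sq; rewrite (leq_trans (size_polyMleq _ _)) //; lia. Qed.

Lemma coef_mul_top p q d e : (size p <= d.+1)%N -> (size q <= e.+1)%N ->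
  (p * q)`_(d + e) = p`_d * q`_e.
Proof.
move=> sp sq; rewrite coefM.
have lt : (d < (d + e).+1)%N by lia.
rewrite (bigD1 (Ordinal lt)) //= big1 ?addr0 ?addKn // => j.
rewrite -val_eqE /= => jd; have [lj|lj] := ltnP j d.
  by rewrite [q`__]nth_default ?mulr0 // (leq_trans sq) //; lia.
by rewrite nth_default ?mul0r // (leq_trans sp) //; lia.
Qed.

Lemma poly_expand p :
  p = \sum_(k < size p) (p`_k)%:P * 'X^k.
Proof.
by rewrite -[LHS]coefK poly_def; apply: eq_bigr => k _; rewrite mul_polyC.
Qed.

(** Division by the monic polynomial ['X - c] lowers the degree by one and keeps
    the leading coefficient. *)
Lemma size_divX (c : R) (g : {poly R}) n :
  (size (('X - c%:P) * g)%R <= n.+2)%N ->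
  (size g <= n.+1)%N /\ g`_n = (('X - c%:P) * g)`_n.+1.
Proof.
move=> s; have sg : (size g <= n.+1)%N.
  have [->|g0] := eqVneq g 0; first by rewrite size_poly0.
  by move: s; rewrite size_monicM ?monicXsubC // size_XsubC.
split=> //; rewrite -[n.+1]/((1 + n)%N) coef_mul_top ?size_XsubC //.
by rewrite coefB coefX coefC subr0 mul1r.
Qed.

Definition is_ideal (J : R -> Prop) :=
  [/\ J 0, (forall f g, J f -> J g -> J (f + g)) & forall r f, J f -> J (r *
    f)].

(** Divisibility is tested modulo an ideal [J] of coefficients, without forming
    the quotient ring. By downward induction on [k]: up to multiples of the
    coefficients of [c] of index greater than [k], the coefficient of [c * p] of
    index [d + k] is the product of [c`_k] and the invertible [p`_d]. *)
Lemma ideal_div (J : R -> Prop) (p c : {poly R}) d u e : is_ideal J ->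
    (size p <= d.+1)%N -> u * p`_d = 1 ->
    (forall k, (d + e <= k)%N -> J (c * p)`_k) ->
  forall k, (e <= k)%N -> J c`_k.
Proof.
move=> [Jz0 JD JM] sp up Jcp k.
move: {2}(size c - k)%N (leqnn (size c - k)) => n;
  elim: n k => [|n IHn] k lek ek.
  by rewrite nth_default // -subn_eq0 -leqn0.
have [lt|le] := ltnP k (size c); last by rewrite nth_default.
have {IHn} IHn j : (k < j)%N -> J c`_j by move=> kj; apply: IHn; lia.
rewrite -[c`_k]mulr1 -up mulrCA; apply: (JM).
have := Jcp (d + k)%N ltac:(lia); rewrite coefM.
have ltk : (k < (d + k).+1)%N by lia.
rewrite (bigD1 (Ordinal ltk)) //= addnK => Jk.
pose z := \sum_(j < (d + k).+1 | j != Ordinal ltk) c`_j * p`_(d + k - j).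
have Jz : J z.
  apply: big_ind => // j; rewrite -val_eqE /= => jk; have [kj|jk'] := ltnP k j.
    by rewrite mulrC; apply: (JM); apply: IHn.
  by rewrite (coef_size0 sp) ?mulr0 //; lia.
rewrite -[_ * _](addrK z); apply: (JD) => //.
by rewrite -mulN1r; apply: (JM).
Qed.

Definition id2 (u v f : R) := exists a b, f = u * a + v * b.

Lemma id2_ideal u v : is_ideal (id2 u v).
Proof.
split=> [|f g [a [b ->]] [a' [b' ->]]|r f [a [b ->]]].
- by exists 0, 0; ring.
- by exists (a + a'), (b + b'); ring.
- by exists (r * a), (r * b); ring.
Qed.

Lemma id2_poly u v p : (forall k, id2 u v p`_k) ->
  exists p1 p2, p = u%:P * p1 + v%:P * p2.
Proof.
elim/poly_ind: p => [|p c IHp] h; first by exists 0, 0; ring.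
have [k|p1 [p2 ->]] := IHp; first by have := h k.+1;
  rewrite coefD coefMX coefC addr0.
have := h 0%N; rewrite coefD coefMX coefC add0r => -[a [b ->]].
exists (p1 * 'X + a%:P), (p2 * 'X + b%:P); rewrite rmorphD !rmorphM /=; ring.
Qed.

(** The bound on the size of the quotient makes the induction on degrees in
    [generate_size] terminate. *)
Lemma poly_divide (d f : {poly R}) n u : (size d <= n.+1)%N -> u * d`_n = 1 ->
  exists q r, [/\ f = q * d + r, (size r <= n)%N
    & (size q <= size f - n)%N].
Proof.
move=> sd ud.
have szd : size (u *: d) = n.+1.
  apply/eqP; rewrite eqn_leq (leq_trans (size_scale_leq _ _)) //=.
  rewrite ltnNge; apply/negP => /leq_sizeP/(_ n (leqnn n)).
  by rewrite coefZ ud => /eqP; rewrite oner_eq0.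
have md : u *: d \is monic by rewrite monicE lead_coefE szd coefZ /= ud.
have nz : u *: d != 0 by rewrite -size_poly_eq0 szd.
have sr : (size (Pdiv.Ring.rmodp f (u *: d)) <= n)%N.
  by rewrite -ltnS -szd; apply: Pdiv.Ring.ltn_rmodpN0.
have fE := Pdiv.RingMonic.rdivp_eq md f.
exists (u *: Pdiv.Ring.rdivp f (u *: d)), (Pdiv.Ring.rmodp f (u *: d));
  split=> //.
  by rewrite [LHS]fE -scalerAl scalerAr.
rewrite (leq_trans (size_scale_leq _ _)) //.
move: fE sr; move: (Pdiv.Ring.rdivp _ _) (Pdiv.Ring.rmodp _ _) => q r fE sr.
have [->|q0] := eqVneq q 0; first by rewrite size_poly0.
have sqd : size (q * (u *: d)) = (size q + n)%N by rewrite size_Mmonic // szd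
  addnS.
have q1 : (0 < size q)%N by rewrite lt0n size_poly_eq0.
rewrite fE size_polyDl sqd ?addnK //.
by rewrite (leq_ltn_trans sr) // -[X in (X < _)%N]add0n ltn_add2r.
Qed.

End TopCoefficient.

(** * Reduction in three variables modulo the relations *)
(** The module of pairs [(f, g)] generated by [(xl, 0)], [(0, xl)],
    [(ym * Q1, 0)], [(0, ym)], [(D * h, h)] and [(Q3 * h, 0)]. With
    [xl = x1 ^+ l], [ym = x2 ^+ m], [Q1 = Q(x1, x2)], [Q3 = Q(x3, x2)], [D] their
    divided difference and [h = hsum l x1 x3], these are the pairs for which
    [e f + tau g] vanishes in the cyclotomic quotient, where [e = e(121)] and
    [tau = psi1 psi2 psi1 e]. *)
Definition rel121 (S : comNzRingType) (xl ym Q1 Q3 D h f g : S) :=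
  exists a1 a2 a3 a4 a5 c,
    f = xl * a1 + ym * Q1 * a4 + D * h * c + Q3 * h * a3 /\
    g = xl * a2 + ym * a5 + h * c.

(** Polynomials in [x1, x2, x3] are nested, with [x3] the outermost variable and
    [x1] the innermost one. Here [l'], [a'] are the predecessors of the level [l]
    and of [a = - a_12], so that the bound [l - a_12 - 2] reads [l' + a'], and
    [A] is [Q(x1, x2)], which is constant in [x3]. The factors [uA], [uD] invert
    the leading coefficients of [A] and [D]. *)
Section NormalForm.
Variable K : fieldType.
Local Notation B := {poly K}.
Local Notation C := {poly {poly K}}.
Local Notation S := {poly {poly {poly K}}}.
Local Notation x1 := ('X%:P%:P : S).
Local Notation x2 := ('X%:P : S).
Local Notation x3 := ('X : S).

Variables (l' m a' b : nat) (A : C) (D Qx3 h : S) (uA : B) (uD : C).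
Local Notation l := l'.+1.
Local Notation a := a'.+1.
Hypothesis sA : (size A <= b.+1)%N.
Hypothesis uAb : uA * A`_b = 1.
Hypothesis sD : (size D <= a'.+1)%N.
Hypothesis uDa : uD * D`_a' = 1.
Hypothesis Qx3E : Qx3 = A%:P + (x3 - x1) * D.
Hypothesis sh : (size h <= l'.+1)%N.
Hypothesis hl : h`_l' = 1.

Local Notation Jred := (rel121 (x1 ^+ l) (x2 ^+ m) A%:P Qx3 D h).

Lemma Qx3_top : (size Qx3 <= a.+1)%N /\ Qx3`_a = D`_a'.
Proof.
have sX : (size (x3 - x1)%R <= 2)%N by rewrite size_XsubC.
have sXD : (size ((x3 - x1) * D)%R <= a.+1)%N := size_mul_top sX sD.
split.
  rewrite Qx3E (leq_trans (size_polyD _ _)) // geq_max sXD andbT.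
  by rewrite (leq_trans (size_polyC_leq1 _)).
rewrite Qx3E coefD coefC add0r -[a]/((1 + a')%N) coef_mul_top //.
by rewrite coefB coefX coefC subr0 mul1r.
Qed.

Definition reduced n2 n3 (F : S) := [/\ (size F <= n3)%N,
  (forall k, (size (F`_k)%R <= n2)%N) & forall k j, (size (F`_k`_j)%R <= l)%N].

Local Notation alpha := ('X%:P ^+ l : C).
Local Notation omega := ('X ^+ m : C).

Lemma alphaE : x1 ^+ l = alpha%:P. Proof. by rewrite [in RHS]rmorphXn. Qed.
Lemma omegaE : x2 ^+ m = omega%:P. Proof. by rewrite [in RHS]rmorphXn. Qed.
Lemma coef_alpha (u : C) j : (alpha * u)`_j = 'X ^+ l * u`_j.
Proof. by rewrite -rmorphXn coefCM. Qed.

Lemma mulXn_size n (w : B) : (size ('X ^+ n * w)%R <= n)%N -> 'X ^+ n * w = 0.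
Proof.
have [->|w0] := eqVneq w 0; first by rewrite mulr0.
by rewrite mulrC size_mulXn // -{2}[n]addn0 leq_add2l leqn0 size_poly_eq0
  (negPf w0).
Qed.

Lemma div_omega (u v w : C) : alpha * u + omega * v = 0 -> exists w, v = alpha
  * w.
Proof.
move=> e; exists (- drop_poly m u); apply/polyP => j.
have := congr1 (fun p : C => p`_(j + m)) e.
rewrite coefD coef_alpha coef0 [omega * v]mulrC coefMXn ltnNge leq_addl /=
  addnK => e'.
rewrite coef_alpha coefN coef_drop_poly mulrN; apply/eqP.
by rewrite -addr_eq0 addrC e'.
Qed.

(** Only [D * h] and [Qx3 * h] involve [x3] in the first component, and only [h]
    in the second one. Modulo the ideal [(x1 ^+ l, x2 ^+ m)] of coefficients, the
    degree bounds in [x3] force [c] and [a3] to vanish, by division by [h], [D]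
    and [Qx3]; this gives [G = 0]. What is left of [F] is divisible by [x2 ^+ m],
    and the quotient is a combination of [A] and [D * h] only, because [Qx3] is
    [A] plus a multiple of [D]. Division by [D * h] modulo [(x1 ^+ l, A)] then
    puts [F] in [(x1 ^+ l, x2 ^+ m * A)], where the bounds in [x2] and [x1] leave
    only 0. *)
Theorem reduced_rel121_eq0 F G : Jred F G -> reduced (m + b) (l' + a') F ->
  reduced m l G ->
  F = 0 /\ G = 0.
Proof.
move=> [a1 [a2 [a3 [a4 [a5 [c [FE GE]]]]]]] [sF3 sF2 sF1] [sG3 sG2 sG1].
rewrite alphaE omegaE in FE GE.
pose J1 := id2 alpha omega; have iJ1 : is_ideal J1 := id2_ideal _ _.
have [J10 J1D J1M] := iJ1.
have J1N f : J1 f -> J1 (- f) by move=> J1f; rewrite -mulN1r; apply: (J1M).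
have J1B f g : J1 f -> J1 g -> J1 (f - g) by move=> *; apply: (J1D);
  last exact: J1N.
have J1a u : J1 (alpha * u) by exists u, 0; rewrite mulr0 addr0.
have J1o u : J1 (omega * u) by exists 0, u; rewrite mulr0 add0r.
have hE : 1 * h`_l' = 1 by rewrite hl mulr1.
have Gk k : (c * h)`_k = G`_k - alpha * a2`_k - omega * a5`_k.
  by rewrite GE !coefD !coefCM [c * h]mulrC; ring.
(* Up to [J1], [c * h] is [G], of degree less than [l]; so [c] is constant. *)
have c1 k : (1 <= k)%N -> J1 c`_k.
  apply: (ideal_div iJ1 sh hE) => {}k lek; rewrite Gk (coef_size0 sG3);
    last by lia.
  by apply: (J1B _ _ _ (J1o _)); apply: (J1B _ _ _ (J1a _)).
have Dc k : (a <= k)%N -> J1 (D * c)`_k.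
  move=> ak; rewrite coefM; apply: big_ind => // j _; have [ja|ja] := leqP j a'.
    by apply: (J1M); apply: c1; lia.
  by rewrite (coef_size0 sD) ?mul0r.
have Fk k : ((D * c + Qx3 * a3) * h)`_k = F`_k - alpha * a1`_k - omega * (A *
  a4`_k).
  have -> : (D * c + Qx3 * a3) * h = F - alpha%:P * a1 - omega%:P * (A%:P * a4).
    by rewrite FE; ring.
  by rewrite !coefB !coefCM.
have Ek k : (a' <= k)%N -> J1 (D * c + Qx3 * a3)`_k.
  apply: (ideal_div iJ1 sh hE) => {}k lek; rewrite Fk (coef_size0 sF3);
    last by lia.
  by apply: (J1B _ _ _ (J1o _)); apply: (J1B _ _ _ (J1a _)).
have [sQ topQ] := Qx3_top; have uQ : uD * Qx3`_a = 1 by rewrite topQ.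
(* [D * c] has degree less than [a] up to [J1], and [Qx3] has degree [a]. *)
have a3k k : J1 a3`_k.
  apply: (ideal_div (e := 0) iJ1 sQ uQ) => // {}k lek; rewrite addn0 in lek.
  have -> : (a3 * Qx3)`_k = (D * c + Qx3 * a3)`_k - (D * c)`_k.
    by rewrite coefD addrC addKr mulrC.
  by apply: (J1B); [apply: Ek; lia | apply: Dc].
have ck k : J1 c`_k.
  apply: (ideal_div (e := 0) iJ1 sD uDa) => // {}k lek; rewrite addn0 in lek.
  have -> : (c * D)`_k = (D * c + Qx3 * a3)`_k - (Qx3 * a3)`_k.
    by rewrite coefD addrK mulrC.
  apply: (J1B); first exact: Ek.
  by rewrite coefM; apply: big_ind => // j _; apply: (J1M).
have G0 : G = 0.
  apply/polyP => k; rewrite coef0.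
  have [u [v Gkuv]] : J1 G`_k.
    rewrite GE !coefD !coefCM; apply: (J1D); first by apply: (J1D).
    by rewrite coefM; apply: big_ind => // j _; apply: (J1M).
  apply/polyP => j; rewrite coef0; have [jm|mj] := ltnP j m; last first.
    by rewrite (coef_size0 (sG2 k)).
  have E : G`_k`_j = 'X ^+ l * u`_j.
    by rewrite Gkuv coefD coef_alpha mulrC [omega * v]mulrC coefMXn jm addr0
      mulrC.
  by rewrite E; apply: mulXn_size; rewrite -E.
split=> //.
have [c' [c'' cE]] := id2_poly ck; have [d' [d'' dE]] := id2_poly a3k.
pose Mk := a1 + D * h * c' + Qx3 * h * d'.
pose gam := c'' + (x3 - x1) * d''.
pose Bk := A%:P * (a4 + h * d'') + gam * (D * h).
(* [Bk] is what remains of [F] after division by [x2 ^+ m] modulo [x1 ^+ l]. *)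
have FMB : F = alpha%:P * Mk + omega%:P * Bk.
  by rewrite FE cE dE /Mk /Bk /gam Qx3E; ring.
pose J2 := id2 alpha A; have iJ2 : is_ideal J2 := id2_ideal _ _.
have [J20 J2D J2M] := iJ2.
have J2A u : J2 (A * u) by exists 0, u; rewrite mulr0 add0r.
have Fk' k : F`_k = alpha * Mk`_k + omega * Bk`_k by rewrite FMB coefD !coefCM.
have uDh : uD * (D * h)`_(a' + l') = 1 by rewrite coef_mul_top // hl mulr1.
have gamk k : J2 gam`_k.
  apply: (ideal_div (e := 0) iJ2 (size_mul_top sD sh) uDh) => // {}k lek.
  have -> : (gam * (D * h))`_k = Bk`_k - A * (a4 + h * d'')`_k.
    by rewrite /Bk [in RHS]coefD coefCM addrC addKr.
  apply: (J2D); last by rewrite -mulrN; apply: J2A.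
  have [|w ->] := @div_omega (Mk`_k) (Bk`_k) 0.
    by rewrite -Fk' (coef_size0 sF3) //; lia.
  by exists w, 0; rewrite mulr0 addr0.
have Bk2 k : J2 Bk`_k.
  rewrite /Bk coefD coefCM; apply: (J2D) => //.
  by rewrite coefM; apply: big_ind => // j _; rewrite mulrC; apply: (J2M).
apply/polyP => k; rewrite coef0.
have [u [v E]] : exists u v, F`_k = alpha * u + v * (omega * A).
  have [u [v Bkuv]] := Bk2 k; exists (Mk`_k + omega * u), v.
  by rewrite Fk' Bkuv; ring.
pose J3 (f : B) := exists w, f = 'X ^+ l * w.
have iJ3 : is_ideal J3.
  split=> [|f g [w ->] [w' ->]|r f [w ->]]; first by exists 0; rewrite mulr0.
    by exists (w + w'); ring.
  by exists (r * w); ring.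
have [J30 J3D J3M] := iJ3.
have so : (size omega <= m.+1)%N by rewrite size_polyXn.
have uoA : uA * (omega * A)`_(m + b) = 1.
  by rewrite coef_mul_top // coefXn eqxx mul1r.
have vk j : J3 v`_j.
  apply: (ideal_div (e := 0) iJ3 (size_mul_top so sA) uoA) => // {}j lej.
  have -> : (v * (omega * A))`_j = F`_k`_j + 'X ^+ l * - u`_j.
    by rewrite E coefD coef_alpha; ring.
  by rewrite (coef_size0 (sF2 k)) ?add0r; [exists (- u`_j) | lia].
apply/polyP => j; rewrite coef0.
have [w Fw] : J3 F`_k`_j.
  rewrite E coefD coef_alpha; apply: (J3D); first by exists u`_j.
  by rewrite coefM; apply: big_ind => // t _; rewrite mulrC; apply: (J3M).
by rewrite Fw; apply: mulXn_size; rewrite -Fw.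
Qed.

Section Generation.
Variable Sp : S -> S -> Prop.
Hypothesis SpB : forall f g f' g', Sp f g -> Sp f' g' -> Sp (f - f') (g - g').
Hypothesis SpJ : forall f g, Jred f g -> Sp f g.
Hypothesis Sp1 : forall k c1 c2 c3, (c1 < l)%N -> (c2 < m + b)%N ->
  (c3 < l' + a')%N -> Sp (k%:P%:P%:P * (x1 ^+ c1 * x2 ^+ c2 * x3 ^+ c3)) 0.
Hypothesis Sp2 : forall k c1 c2 c3, (c1 < l)%N -> (c2 < m)%N ->
  (c3 < l)%N -> Sp 0 (k%:P%:P%:P * (x1 ^+ c1 * x2 ^+ c2 * x3 ^+ c3)).
Hypothesis hE : (x1 - x3) * h = x1 ^+ l - x3 ^+ l.

Lemma Sp0 : Sp 0 0.
Proof. by apply: SpJ; exists 0, 0, 0, 0, 0, 0; split; ring. Qed.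

Definition additive_set (P : S -> Prop) :=
  P 0 /\ forall f g, P f -> P g -> P (f + g).

Lemma SpD f g f' g' : Sp f g -> Sp f' g' -> Sp (f + f') (g + g').
Proof.
move=> h1 h2; rewrite -[f']opprK -[g']opprK; apply: SpB => //.
by rewrite -[- f']sub0r -[- g']sub0r; apply: SpB => //; apply: Sp0.
Qed.

Lemma additive_left : additive_set (fun f => Sp f 0).
Proof.
by split=> [|f g Pf Pg]; [exact: Sp0 | rewrite -[X in Sp _ X]addr0; apply: SpD].
Qed.

Lemma additive_right : additive_set (fun g => Sp 0 g).
Proof.
by split=> [|f g Pf Pg]; [exact: Sp0 | rewrite -[X in Sp X _]addr0; apply: SpD].
Qed.

(** Coefficients in [x1] and [x2] are reduced by two divisions, by [d] and by the
    power of [x1]. *)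
Lemma generate_C (P : S -> Prop) (d : C) (u : B) n (y : S) : additive_set P ->
    (size d <= n.+1)%N -> u * d`_n = 1 ->
    (forall f, P (x1 ^+ l * f)) -> (forall f, P (d%:P * f)) ->
    (forall k c1 c2, (c1 < l)%N -> (c2 < n)%N ->
       P (k%:P%:P%:P * (x1 ^+ c1 * x2 ^+ c2) * y)) ->
  forall c : C, P (c%:P * y).
Proof.
move=> [P0 PD] sd ud Px Pd Pk c.
have [qq [r [-> sr _]]] := poly_divide c sd ud.
rewrite rmorphD mulrDl; apply: (PD); first by rewrite rmorphM mulrAC mulrC.
rewrite [r]poly_expand rmorph_sum mulr_suml; apply: big_ind => // j _.
have jn : (j < n)%N by apply: leq_trans sr.
have sX : (size ('X^l : B) <= l.+1)%N by rewrite size_polyXn.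
have uX : 1 * ('X^l : B)`_l = 1 by rewrite coefXn eqxx mul1r.
have [q2 [w [-> sw _]]] := poly_divide r`_j sX uX.
have -> : ((q2 * 'X^l + w)%:P * 'X^j)%:P * y
    = x1 ^+ l * (q2%:P%:P * x2 ^+ j * y) + w%:P%:P * x2 ^+ j * y.
  by rewrite !(rmorphM, rmorphD, rmorphXn) /=; ring.
apply: (PD); first exact: Px.
rewrite [w]poly_expand !rmorph_sum !mulr_suml; apply: big_ind => // t _.
rewrite !rmorphM !rmorphXn /= -[_ * _ * x2 ^+ j]mulrA; apply: Pk => //.
exact: leq_trans sw.
Qed.

Lemma generate_low_left (f : S) : (size f <= l' + a')%N -> Sp f 0.
Proof.
move=> sf; have [P0 PD] := additive_left.
rewrite [f]poly_expand; elim/big_ind: _ => // k _.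
have so : (size ('X^m * A : C)%R <= (m + b).+1)%N.
  by apply: size_mul_top => //; rewrite size_polyXn.
have uo : uA * ('X^m * A : C)`_(m + b) = 1.
  by rewrite coef_mul_top ?size_polyXn // coefXn eqxx mul1r.
refine (@generate_C (fun g => Sp g 0) _ _ _ (x3 ^+ k) additive_left so uo _ _ _
  f`_k) => /= [g|g|c c1 c2 h1 h2].
- by apply: SpJ; exists g, 0, 0, 0, 0, 0; split; ring.
- apply: SpJ; exists 0, 0, 0, g, 0, 0; rewrite rmorphM rmorphXn.
  by split; ring.
- by rewrite -mulrA; apply: Sp1 => //; apply: leq_trans sf.
Qed.

Lemma generate_low_right (f : S) : (size f <= l)%N -> Sp 0 f.
Proof.
move=> sf; have [P0 PD] := additive_right.
rewrite [f]poly_expand; elim/big_ind: _ => // k _.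
have so : (size ('X^m : C) <= m.+1)%N by rewrite size_polyXn.
have uo : 1 * ('X^m : C)`_m = 1 by rewrite coefXn eqxx mul1r.
refine (@generate_C (fun g => Sp 0 g) _ _ _ (x3 ^+ k) additive_right so uo _ _
  _ f`_k) => /= [g|g|c c1 c2 h1 h2].
- by apply: SpJ; exists 0, g, 0, 0, 0, 0; split; ring.
- apply: SpJ; exists 0, 0, 0, 0, g, 0; rewrite rmorphXn.
  by split; ring.
- by rewrite -mulrA; apply: Sp2 => //; apply: leq_trans sf.
Qed.

(** In the cyclotomic quotient, [tau x3^l = Q(x1, x2) h e]. *)
Lemma x3_pow : Jred (- (A%:P * h)) (x3 ^+ l).
Proof.
have -> : x3 ^+ l = x1 ^+ l - (x1 - x3) * h by rewrite hE; ring.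
by exists 0, 1, (- 1), 0, 0, (x3 - x1); rewrite Qx3E; split; ring.
Qed.

Lemma rel121M f g k : Jred f g -> Jred (f * k) (g * k).
Proof.
move=> [a1 [a2 [a3 [a4 [a5 [c [-> ->]]]]]]].
by exists (a1 * k), (a2 * k), (a3 * k), (a4 * k), (a5 * k), (c * k); split;
  ring.
Qed.

Lemma size_mul_le (p q : S) d n : (size p <= d.+1)%N -> (size q <= n)%N ->
  (size (p * q)%R <= d + n)%N.
Proof.
case: n => [|n] sp sq; last by rewrite addnS; apply: size_mul_top.
by move: sq; rewrite leqn0 size_poly_eq0 => /eqP ->; rewrite mulr0 size_poly0.
Qed.

(** The two components reduce each other. The multiple [tau x3^l q] is replaced
    by [Q(x1, x2) h q], of smaller degree in [x3]; the multiple [D h q] of [e] is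
    replaced by [- tau h q], of degree in [x3] at most that of [D h q]. The
    induction on the degree therefore treats [tau] before [e]. *)
Lemma generate_size n (f : S) : (size f <= n)%N -> Sp f 0 /\ Sp 0 f.
Proof.
elim: n f => [|n IHn] f.
  by rewrite leqn0 size_poly_eq0 => /eqP ->; split; apply: Sp0.
have right (g : S) : (size g <= n.+1)%N -> Sp 0 g.
  move=> sg; rewrite -[g](poly_take_drop l).
  have [_ PD] := additive_right; apply: PD.
    by apply: generate_low_right; apply: size_take_poly.
  set d := drop_poly l g.
  have sd : (size d <= n - l')%N by rewrite size_drop_poly; lia.
  have [->|d0] := eqVneq d 0; first by rewrite mul0r; apply: Sp0.
  have d1 : (0 < size d)%N by rewrite lt0n size_poly_eq0.
  have [lo _] : Sp (A%:P * h * d) 0 /\ Sp 0 (A%:P * h * d).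
    apply: IHn; rewrite -mulrA;
      apply: leq_trans (_ : 0 + (l' + (n - l')) <= n)%N.
      by apply: size_mul_le; [rewrite size_polyC_leq1 | apply: size_mul_le].
    by rewrite add0n subnKC // ltnW // -subn_gt0; apply: leq_trans sd.
  have := SpD (SpJ (rel121M d x3_pow)) lo.
  by rewrite mulNr addNr addr0 mulrC.
move=> sf; split; last exact: right.
have uDh : uD * (D * h)`_(a' + l') = 1 by rewrite coef_mul_top // hl mulr1.
have [d [r [fE sr sd]]] := poly_divide f (size_mul_top sD sh) uDh.
rewrite fE; have [_ PD] := additive_left; apply: PD; last first.
  by apply: generate_low_left; rewrite addnC.
have [->|d0] := eqVneq d 0; first by rewrite mul0r; apply: Sp0.
have d1 : (0 < size d)%N by rewrite lt0n size_poly_eq0.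
have hd : Sp 0 (h * d).
  apply: right; apply: leq_trans (size_mul_le sh sd) _.
  have : (a' + l' < size f)%N by rewrite -subn_gt0; apply: leq_trans sd.
  by move: sf; move: (size f) => N; lia.
have JDh : Jred (D * h * d) (h * d) by exists 0, 0, 0, 0, 0, d; split; ring.
by have := SpB (SpJ JDh) hd; rewrite subr0 subrr mulrC.
Qed.

Lemma generate f g : Sp f g.
Proof.
rewrite -[f]addr0 -[g]add0r; apply: SpD.
  by have [] := generate_size (leqnn (size f)).
by have [] := generate_size (leqnn (size g)).
Qed.

End Generation.

End NormalForm.

(** * The residue sequences 121, 211 and 112 *)
(** Positions and blocks are elements of ['I_3], and the two elements of ['I_2]
    index [psi1] and [psi2]; everything is shifted to start from 0. *)
Notation o0 := (@Ordinal 3 0 isT).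
Notation o1 := (@Ordinal 3 1 isT).
Notation o2 := (@Ordinal 3 2 isT).
Notation r0 := (@Ordinal 2 0 isT).
Notation r1 := (@Ordinal 2 1 isT).

Lemma ord3P (P : 'I_3 -> Prop) : P o0 -> P o1 -> P o2 -> forall s, P s.
Proof.
move=> P0 P1 P2 [[|[|[|]]]] // h.
- by rewrite (_ : Ordinal h = o0) //; apply: val_inj.
- by rewrite (_ : Ordinal h = o1) //; apply: val_inj.
- by rewrite (_ : Ordinal h = o2) //; apply: val_inj.
Qed.

Lemma ord2P (P : 'I_2 -> Prop) : P r0 -> P r1 -> forall s, P s.
Proof.
move=> P0 P1 [[|[|]]] // h.
- by rewrite (_ : Ordinal h = r0) //; apply: val_inj.
- by rewrite (_ : Ordinal h = r1) //; apply: val_inj.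
Qed.

Section Monomial.
Variable T : nzRingType.

(** Each generator permutes the residue sequences, hence acts by a monomial
    matrix, and products are computed one row at a time by [monomial_mx_row]. *)
Definition monomial_mx (f : 'I_3 -> 'I_3) (P : 'I_3 -> T) : 'M[T]_3 :=
  \matrix_(s, t) if t == f s then P s else 0.

Lemma monomial_mx_row f P (M : 'M[T]_3) s t : (monomial_mx f P * M) s t = P s *
  M (f s) t.
Proof.
rewrite mxE (bigD1 (f s)) //= big1 ?addr0; last first.
  by move=> k /negPf ks; rewrite mxE ks mul0r.
by rewrite mxE eqxx.
Qed.

Lemma scalar_mx3 (c : T) : c%:M = monomial_mx id (fun=> c).
Proof. by apply/matrixP => s t; rewrite !mxE eq_sym; case: eqP. Qed.

End Monomial.

Section Representation.
Variables (I : choiceType) (C : cartan_datum I) (X : realization C).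
Variables (K : fieldType) (Q : I -> I -> {poly {poly K}}).
Variables (i1 i2 : I).
Hypothesis i12 : i1 != i2.
Hypothesis Qd : forall i, Q i i = 0.
Hypothesis Q21 : Q i2 i1 = swapXY (Q i1 i2).

Local Notation beta := (simple_root X i1 *+ 2 + simple_root X i2).

(** Block 0 is [121], block 1 is [211] and block 2 is [112]. They are obtained
    from [121] by simple transpositions, so that their membership in [Ibeta] is
    inherited. *)
Definition nu (s : 'I_3) : Ibeta 3 beta :=
  match val s with
  | 0%N => nu121 X i1 i2
  | 1%N => @perm_Ibeta I C X 3 beta (@simple_perm 3 r0) (nu121 X i1 i2)
  | _ => @perm_Ibeta I C X 3 beta (@simple_perm 3 r1) (nu121 X i1 i2)
  end.

Definition swap_block (r : 'I_2) (s : 'I_3) : 'I_3 :=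
  match val r, val s with
  | 0%N, 0%N => o1 | 0%N, 1%N => o0 | 0%N, _ => o2
  | _, 0%N => o2 | _, 1%N => o1 | _, _ => o0
  end.

Lemma swap_blockK r : involutive (swap_block r).
Proof. by elim/ord2P: r; elim/ord3P. Qed.

Definition block_word (s : 'I_3) : seq I :=
  nth [::] [:: [:: i1; i2; i1]; [:: i2; i1; i1]; [:: i1; i1; i2]] s.

Lemma color_perm r (v : Ibeta 3 beta) k :
  color (perm_Ibeta (@simple_perm 3 r) v) k = color v (@simple_perm 3 r k).
Proof. by rewrite /color tnth_mktuple tpermV. Qed.

Lemma pos0 : @pos 3 r0 = o0. Proof. exact: val_inj. Qed.
Lemma pos1 : @pos 3 r1 = o1. Proof. exact: val_inj. Qed.
Lemma posS0 : @posS 3 r0 = o1. Proof. exact: val_inj. Qed.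
Lemma posS1 : @posS 3 r1 = o2. Proof. exact: val_inj. Qed.
Definition posE := (pos0, pos1, posS0, posS1).

Lemma color_nu s k : color (nu s) k = nth i1 (block_word s) k.
Proof.
have e121 t : color (nu121 X i1 i2) t = nth i1 (block_word o0) t.
  by rewrite /color (tnth_nth i1).
elim/ord3P: s; rewrite /nu /=; rewrite ?color_perm e121 //;
  by elim/ord3P: k; rewrite /simple_perm !posE permE /=.
Qed.

Lemma nu_eq v s : (forall k, color v k = nth i1 (block_word s) k) -> v = nu s.
Proof.
move=> h; apply: val_inj; apply: eq_from_tnth => k.
by rewrite -[LHS]/(color v k) -[RHS]/(color (nu s) k) h color_nu.
Qed.

Lemma nu_swap_block r s : perm_Ibeta (@simple_perm 3 r) (nu s) = nu (swap_block
  r s).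
Proof.
apply: nu_eq => k; rewrite color_perm color_nu.
by elim/ord2P: r; elim/ord3P: s; elim/ord3P: k;
   rewrite /simple_perm !posE permE.
Qed.

Lemma nu_inj : injective nu.
Proof.
move=> s t st.
have {st} h k : nth i1 (block_word s) k = nth i1 (block_word t) k.
  have [lt|le] := ltnP k 3; first by rewrite -!(color_nu _ (Ordinal lt)) st.
  by rewrite !nth_default //; [elim/ord3P: (t) | elim/ord3P: (s)].
have [h0 h1 h2] : [/\ nth i1 (block_word s) 0 = nth i1 (block_word t) 0,
  nth i1 (block_word s) 1 = nth i1 (block_word t) 1 & nth i1 (block_word s) 2 =
    nth i1 (block_word t) 2].
  by [].
move: (i12) h0 h1 h2; clear; rewrite -[_ != _]/(~~ (_ == _)) => ne.
by elim/ord3P: s; elim/ord3P: t => //= *; case/eqP: ne.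
Qed.

Lemma nu_permE r v s :
  (perm_Ibeta (@simple_perm 3 r) v == nu s) = (v == nu (swap_block r s)).
Proof.
have permK (w : Ibeta 3 beta) : perm_Ibeta (@simple_perm 3 r) (perm_Ibeta
  (@simple_perm 3 r) w) = w.
  have e k : color (perm_Ibeta (@simple_perm 3 r) (perm_Ibeta (@simple_perm 3
    r) w)) k = color w k.
    by rewrite !color_perm tpermK.
  by apply: val_inj; apply: eq_from_tnth => k; apply: e.
apply/eqP/eqP => [e|->]; first by rewrite -nu_swap_block -e permK.
by rewrite nu_swap_block swap_blockK.
Qed.

(** * The representation of the quiver Hecke algebra by block matrices *)
Variables (S : comNzRingType) (i : {rmorphism K -> S}) (x1 x2 x3 : S).

Local Notation T := 'M[S]_2.
Local Notation q := (Q i1 i2).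
Local Notation F := (free_alg K (QH_gen 3 beta)).

Definition Qx1 := ev2 i q x1 x2.
Definition Qx3 := ev2 i q x3 x2.
Definition Qdiff := dd2 i q x1 x2 x3.

Lemma Qx3E : Qx3 = Qx1 - (x1 - x3) * Qdiff.
Proof.
rewrite /Qdiff dd2P; [by rewrite opprB addrC subrK | | | ]; move=> *;
  exact: mulrC.
Qed.

Lemma dd2_flip : dd2 i q x3 x2 x1 = Qdiff.
Proof. by rewrite (dd2_sym _ _ _ (mulrC x3 x1)). Qed.

(** Right multiplication by polynomials makes the left module generated by
    [e = e(121)] a module with two generators in each block: [e], [tau] in block
    [121]; [psi1 e], [psi2 psi1 e] in block [211]; [psi2 e], [psi1 psi2 e] in
    block [112]. The columns of [x_block k s] express the products of [x_k] with
    the two generators of block [s]. Those of [psi_block r s] express the products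
    of [psi_r] with the generators of block [swap_block r s], which are sent to
    block [s]. *)
Definition x_block (k s : 'I_3) : T :=
  match val k, val s with
  | 0%N, 0%N => mx2 x1 (- Qx1) 0 x3
  | 0%N, 1%N => mx2 x2 0 0 x2
  | 0%N, _ => mx2 x1 (- 1) 0 x3
  | 1%N, 0%N => mx2 x2 0 0 x2
  | 1%N, 1%N => mx2 x1 (- 1) 0 x3
  | 1%N, _ => mx2 x3 1 0 x1
  | _, 0%N => mx2 x3 Qx1 0 x1
  | _, 1%N => mx2 x3 1 0 x1
  | _, _ => mx2 x2 0 0 x2
  end.

Definition psi_block (r : 'I_2) (s : 'I_3) : T :=
  match val r, val s with
  | 0%N, 0%N => mx2 Qx1 0 0 1
  | 0%N, 1%N => mx2 1 (- Qdiff) 0 Qx3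
  | 0%N, _ => mx2 0 0 1 0
  | _, 0%N => mx2 Qx3 Qdiff 0 1
  | _, 1%N => mx2 0 0 1 0
  | _, _ => mx2 1 0 0 Qx1
  end.

Definition rho_gen (g : QH_gen 3 beta) : 'M[T]_3 :=
  match g with
  | inl (inl r) => monomial_mx (swap_block r) (psi_block r)
  | inl (inr k) => monomial_mx id (x_block k)
  | inr v => monomial_mx id (fun s => (v == nu s)%:R)
  end.

Definition rho_scalar (c : K) : 'M[T]_3 := (i c)%:M%:M.

Lemma rho_scalar_morph : exists f : {rmorphism K -> 'M[T]_3}, f =1 rho_scalar.
Proof.
by exists (@scalar_mx T 3 \o (@scalar_mx S 2 \o i)).
Qed.

Lemma rho_scalar_row c (M : 'M[T]_3) s t :
  (rho_scalar c * M) s t = (i c)%:M * M s t.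
Proof. by rewrite /rho_scalar scalar_mx3 monomial_mx_row. Qed.

Lemma rho_scalarC c (M : 'M[T]_3) : rho_scalar c * M = M * rho_scalar c.
Proof.
apply/matrixP => s t; rewrite rho_scalar_row mxE (bigD1 t) //= big1 ?addr0.
  have -> : rho_scalar c t t = (i c)%:M by rewrite /rho_scalar mxE eqxx.
  exact/esym/scalar_mxC.
by move=> k /negPf kt; rewrite /rho_scalar mxE kt mulr0.
Qed.

Lemma rho_exists : exists rho : {rmorphism F -> 'M[T]_3},
  (forall c, rho c%:A = rho_scalar c) /\
  (forall g, rho (free_gen K g) = rho_gen g).
Proof.
have [f fE] := rho_scalar_morph.
have fC c M : f c * M = M * f c by rewrite fE rho_scalarC.
have [rho [rc rg]] := @free_alg_universal K (QH_gen 3 beta) _ f rho_gen fC.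
by exists rho; split=> // c; rewrite rc fE.
Qed.

Variable rho : {rmorphism F -> 'M[T]_3}.
Hypothesis rho_c : forall c, rho c%:A = rho_scalar c.
Hypothesis rho_g : forall g, rho (free_gen K g) = rho_gen g.

Local Notation gpsi := (gen_psi K (n := 3) beta).
Local Notation gx := (gen_x K (n := 3) beta).
Local Notation ge := (gen_e K (n := 3) (beta := beta)).

Lemma rho_psi r M s t : (rho (gpsi r) * M) s t = psi_block r s * M (swap_block
  r s) t.
Proof. by rewrite /gen_psi rho_g monomial_mx_row. Qed.

Lemma rho_x k M s t : (rho (gx k) * M) s t = x_block k s * M s t.
Proof. by rewrite /gen_x rho_g monomial_mx_row. Qed.

Lemma rho_e v M s t : (rho (ge v) * M) s t = (v == nu s)%:R * M s t.
Proof. by rewrite /gen_e rho_g monomial_mx_row. Qed.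

(** The [x_k] preserve each block, so a polynomial in them acts on a row through
    the same polynomial in the blocks. *)
Lemma rho_eval2 p a b A B s :
  (forall M t, (rho a * M) s t = A * M s t) ->
  (forall M t, (rho b * M) s t = B * M s t) ->
  forall M t, (rho (eval2 p a b) * M) s t
    = ev2 (fun c => (i c)%:M) p A B * M s t.
Proof.
move=> ha hb; rewrite eval2E rmorph_ev2.
apply: (@rel_ev2 K _ _ (fun (Y : 'M[T]_3) (y : T) => forall M t, (Y * M) s t =
  y * M s t)) => //.
- by move=> M t; rewrite !mul0r mxE.
- by move=> M t; rewrite !mul1r.
- by move=> Y Y' y y' h h' M t; rewrite mulrDl mxE h h' mulrDl.
- by move=> Y Y' y y' h h' M t; rewrite -mulrA h h' mulrA.
- by move=> c M t; rewrite /= rho_c rho_scalar_row.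
Qed.

Lemma rho_divdiff p a b c A B D s :
  (forall M t, (rho a * M) s t = A * M s t) ->
  (forall M t, (rho b * M) s t = B * M s t) ->
  (forall M t, (rho c * M) s t = D * M s t) ->
  forall M t, (rho (divdiff p a b c) * M) s t
    = dd2 (fun c => (i c)%:M) p A B D * M s t.
Proof.
move=> ha hb hc; rewrite divdiffE rmorph_dd2.
apply: (@rel_dd2 K _ _ (fun (Y : 'M[T]_3) (y : T) => forall M t, (Y * M) s t =
  y * M s t)) => //.
- by move=> M t; rewrite !mul0r mxE.
- by move=> M t; rewrite !mul1r.
- by move=> Y Y' y y' h h' M t; rewrite mulrDl mxE h h' mulrDl.
- by move=> Y Y' y y' h h' M t; rewrite -mulrA h h' mulrA.
- by move=> k M t; rewrite /= rho_c rho_scalar_row.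
Qed.

Lemma ev2_12 p u : ev2 (fun c => (i c)%:M) p (mx2 x1 (- u) 0 x3) x2%:M
  = mx2 (ev2 i p x1 x2) (- u * dd2 i p x1 x2 x3) 0 (ev2 i p x3 x2).
Proof. exact: ev2_triangular. Qed.

Lemma ev2_32 p u : ev2 (fun c => (i c)%:M) p (mx2 x3 u 0 x1) x2%:M
  = mx2 (ev2 i p x3 x2) (u * dd2 i p x3 x2 x1) 0 (ev2 i p x1 x2).
Proof. by rewrite -{1}[u]opprK ev2_triangular opprK. Qed.

Lemma mx2_x2 : mx2 x2 0 0 x2 = x2%:M. Proof. by rewrite mx2_scalar. Qed.

Lemma row_ext (Y Z : 'M[T]_3) :
  (forall M s t, (Y * M) s t = (Z * M) s t) -> Y = Z.
Proof. by move=> h; apply/matrixP => s t; rewrite -[Y]mulr1 -[Z]mulr1 h. Qed.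

Lemma rho_mulrow a b M s t : (rho (a * b) * M) s t = (rho a * (rho b * M)) s t.
Proof. by rewrite rmorphM mulrA. Qed.
Lemma rho_addrow a b M s t :
  (rho (a + b) * M) s t = (rho a * M) s t + (rho b * M) s t.
Proof. by rewrite rmorphD mulrDl mxE. Qed.
Lemma rho_subrow a b M s t :
  (rho (a - b) * M) s t = (rho a * M) s t - (rho b * M) s t.
Proof. by rewrite rmorphB mulrBl !mxE. Qed.
Lemma rho_natrow n M s t : (rho n%:R * M) s t = n%:R * M s t.
Proof.
rewrite rmorph_nat; elim: n => [|n IHn]; first by rewrite !mul0r mxE.
by rewrite !mulrS !mulrDl mxE IHn !mul1r.
Qed.

Definition rho_rows :=
  (rho_mulrow, rho_addrow, rho_subrow, rho_natrow, rho_psi, rho_x, rho_e).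

Lemma x_blockC k l s : x_block k s * x_block l s = x_block l s * x_block k s.
Proof.
move: k l s; elim/ord3P; elim/ord3P; elim/ord3P; rewrite /x_block //= !mx2_mul.
all: by congr mx2; ring.
Qed.

Lemma color_eq21 : (i2 == i1) = false.
Proof. by rewrite eq_sym (negPf i12). Qed.

Lemma color_eq12 : (i1 == i2) = false.
Proof. exact: negPf. Qed.

(** The colors of [v] may be read off the block [s]: both sides vanish unless
    [v = nu s]. *)
Lemma delta_row v s (a b : 'I_3) (m : T) :
  (color v a == color v b)%:R * ((v == nu s)%:R * m)
    = (nth i1 (block_word s) a == nth i1 (block_word s) b)%:R
        * ((v == nu s)%:R * m).
Proof.
have [->|_] := eqVneq v (nu s); last by rewrite !mul0r !mulr0.
by rewrite !color_nu.
Qed.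

Lemma true_mx2 : true%:R = mx2 1 0 0 1 :> T.
Proof. by rewrite -mx2_scalar. Qed.

Lemma rho_psi_x r v : rho (gpsi r * gx (@posS 3 r) * ge v) =
  rho ((gx (@pos 3 r) * gpsi r
        + (color v (@pos 3 r) == color v (@posS 3 r))%:R) * ge v).
Proof.
apply: row_ext => M s t; rewrite !rho_rows delta_row.
elim/ord2P: r; elim/ord3P: s; rewrite /swap_block /= ?posE /=.
all: rewrite ?eqxx ?color_eq12 ?color_eq21 ?mul0r ?addr0 ?true_mx2.
all: rewrite !mulrA -?mulrDl ?mx2_mul ?mx2_add; congr (_ * _ * _).
all: by congr mx2; ring.
Qed.

Lemma rho_x_psi r v : rho (gx (@posS 3 r) * gpsi r * ge v) =
  rho ((gpsi r * gx (@pos 3 r)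
        + (color v (@pos 3 r) == color v (@posS 3 r))%:R) * ge v).
Proof.
apply: row_ext => M s t; rewrite !rho_rows delta_row.
elim/ord2P: r; elim/ord3P: s; rewrite /swap_block /= ?posE /=.
all: rewrite ?eqxx ?color_eq12 ?color_eq21 ?mul0r ?addr0 ?true_mx2.
all: rewrite !mulrA -?mulrDl ?mx2_mul ?mx2_add; congr (_ * _ * _).
all: by rewrite ?Qx3E; congr mx2; ring.
Qed.

Lemma rho_psi_x_far r k : k != @pos 3 r -> k != @posS 3 r ->
  rho (gpsi r * gx k) = rho (gx k * gpsi r).
Proof.
move=> k1 k2; apply: row_ext => M s t; rewrite !rho_rows !mulrA.
congr (_ * _); move: k1 k2; rewrite -!val_eqE.
elim/ord2P: r; elim/ord3P: k => //= _ _; elim/ord3P: s; rewrite !mx2_mul.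
all: by rewrite ?Qx3E; congr mx2; ring.
Qed.

Lemma ev2_block_swap p A B : A * B = B * A :> T ->
  ev2 (fun c => (i c)%:M) (swapXY p) A B = ev2 (fun c => (i c)%:M) p B A.
Proof. exact: (@ev2_swap K _ (@scalar_mx S 2 \o i)). Qed.

(** By [ev2_triangular], the right-hand side is a triangular matrix with
    off-diagonal entry a multiple of [Qdiff]. *)
Lemma rho_psi_sq r v : rho (gpsi r ^+ 2 * ge v) =
  rho (eval2 (Q (color v (@pos 3 r)) (color v (@posS 3 r)))
             (gx (@pos 3 r)) (gx (@posS 3 r)) * ge v).
Proof.
apply: row_ext => M s t; rewrite expr2 rho_mulrow rho_mulrow [in RHS]rho_mulrow.
rewrite (rho_eval2 _ (A := x_block (@pos 3 r) s) (B := x_block (@posS 3 r) s));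
  last 2 first.
- by move=> *; rewrite rho_x.
- by move=> *; rewrite rho_x.
rewrite !rho_rows swap_blockK mulrA.
have [->|_] := eqVneq v (nu s); last by rewrite !mul0r !mulr0.
congr (_ * _); rewrite !color_nu.
elim/ord2P: r; elim/ord3P: s; rewrite ?posE /= ?Qd ?Q21 ?ev2_poly0.
- by rewrite /x_block /psi_block /= mx2_x2 ev2_12 -/Qx1 -/Qx3 -/Qdiff mx2_mul;
  congr mx2; ring.
- rewrite ev2_block_swap; last exact: x_blockC.
  by rewrite /x_block /psi_block /= mx2_x2 ev2_12 -/Qx1 -/Qx3 -/Qdiff mx2_mul;
    congr mx2; ring.
- by rewrite mx2_mul !(mul0r, mulr0, addr0) -mx2_scalar raddf0.
- rewrite ev2_block_swap; last exact: x_blockC.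
  by rewrite /x_block /psi_block /= mx2_x2 ev2_32 dd2_flip -/Qx1 -/Qx3 mx2_mul;
    congr mx2; ring.
- by rewrite mx2_mul !(mul0r, mulr0, addr0) -mx2_scalar raddf0.
- by rewrite /x_block /psi_block /= mx2_x2 ev2_32 dd2_flip -/Qx1 -/Qx3 mx2_mul;
  congr mx2; ring.
Qed.

(** Both braid products return block [121] to itself and exchange the two other
    blocks. The divided difference is symmetric in [x1] and [x3], so by
    [dd2_triangular] it acts on block [121] as the scalar [Qdiff]. *)
Lemma rho_braid (r s : 'I_2) v : s = r.+1 :> nat ->
  rho ((gpsi s * gpsi r * gpsi s - gpsi r * gpsi s * gpsi r) * ge v) =
  rho ((color v (@pos 3 r) == color v (@posS 3 s))%:R
       * divdiff (Q (color v (@pos 3 r)) (color v (@pos 3 s)))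
                 (gx (@pos 3 r)) (gx (@pos 3 s)) (gx (@posS 3 s)) * ge v).
Proof.
elim/ord2P: r; elim/ord2P: s => // _; apply: row_ext => M s t; rewrite ?posE.
rewrite [in RHS]rho_mulrow [in RHS]rho_mulrow rho_natrow.
rewrite (rho_divdiff _ (A := x_block o0 s) (B := x_block o1 s) (D := x_block o2
  s)); last 3 first.
- by move=> *; rewrite rho_x.
- by move=> *; rewrite rho_x.
- by move=> *; rewrite rho_x.
rewrite mulrBl rho_subrow !rho_rows.
elim/ord3P: s; rewrite /swap_block /=.
- have [->|_] := eqVneq v (nu o0); last by rewrite !mul0r !mulr0 subr0.
  rewrite !color_nu /= eqxx !mulrA -mulrBl mul1r; congr (_ * _); rewrite !mulr1.
  rewrite /x_block /psi_block /= mx2_x2 dd2_triangular -/Qdiff.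
  by rewrite !mx2_mul mx2_opp mx2_add mx2_scalar Qx3E; congr mx2; ring.
- have -> Y : (color v o0 == color v o2)%:R * (Y * ((v == nu o1)%:R * M o1 t))
  = 0.
    have [->|_] := eqVneq v (nu o1); last by rewrite mul0r !mulr0.
    by rewrite !color_nu /= color_eq21 mul0r.
  rewrite !mulrA -!mulrBl /psi_block /= !mx2_mul mx2_opp mx2_add ?Qx3E.
  rewrite [X in X * _ * _](_ : _ = mx2 0 0 0 0); last by congr mx2; ring.
  by rewrite -mx2_scalar raddf0 !mul0r.
- have -> Y : (color v o0 == color v o2)%:R * (Y * ((v == nu o2)%:R * M o2 t))
  = 0.
    have [->|_] := eqVneq v (nu o2); last by rewrite mul0r !mulr0.
    by rewrite !color_nu /= color_eq12 mul0r.
  rewrite !mulrA -!mulrBl /psi_block /= !mx2_mul mx2_opp mx2_add ?Qx3E.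
  rewrite [X in X * _ * _](_ : _ = mx2 0 0 0 0); last by congr mx2; ring.
  by rewrite -mx2_scalar raddf0 !mul0r.
Qed.

Lemma rho_rel a b : @QH_rel I C X K Q 3 beta a b -> rho a = rho b.
Proof.
case; clear a b.
- move=> v v'; apply: row_ext => M s t; rewrite !rho_rows.
  have [->|ne] := eqVneq v (nu s); last by rewrite !mul0r mulr0.
  by rewrite mul1r [nu s == _]eq_sym mul1r.
- move=> l ul hl; apply: row_ext => M s t.
  rewrite rmorph1 mul1r rmorph_sum mulr_suml summxE.
  under eq_bigr => v _ do rewrite rho_e.
  rewrite (bigD1_seq (nu s)) //= eqxx mul1r big1 ?addr0 //.
  by move=> v /negPf ->; rewrite mul0r.
- move=> k v; apply: row_ext => M s t; rewrite !rho_rows.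
  by case: (v == nu s); rewrite ?(mul1r, mul0r, mulr0).
- move=> r v; apply: row_ext => M s t; rewrite !rho_rows nu_permE.
  by case: (v == nu _); rewrite ?(mul1r, mul0r, mulr0).
- by move=> k l; apply: row_ext => M s t; rewrite !rho_rows !mulrA x_blockC.
- exact: rho_psi_x.
- exact: rho_x_psi.
- exact: rho_psi_x_far.
- by elim/ord2P; elim/ord2P.
- exact: rho_psi_sq.
- exact: rho_braid.
Qed.

(** * The submodule of cyclotomic relations *)
Variables l m : nat.
Local Notation h := (hsum l x1 x3).

Definition ideal3 (u v w f : S) := exists a b c, f = u * a + v * b + w * c.

Lemma ideal3D u v w f g :
  ideal3 u v w f -> ideal3 u v w g -> ideal3 u v w (f + g).
Proof.
move=> [a [b [c ->]]] [a' [b' [c' ->]]].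
by exists (a + a'), (b + b'), (c + c'); ring.
Qed.

Lemma ideal3Z u v w f k : ideal3 u v w f -> ideal3 u v w (k * f).
Proof.
by move=> [a [b [c ->]]]; exists (k * a), (k * b), (k * c); ring.
Qed.

Definition cyc_rel121 := rel121 (x1 ^+ l) (x2 ^+ m) Qx1 Qx3 Qdiff h.

(** A system of pairs, one module for each block, that is stable under the
    generators and contains the columns of [x1 ^+ l] or [x1 ^+ m] on each block.
    In the blocks [211] and [112] membership is tested on each component
    separately. *)
Definition cyc_rel (s : 'I_3) (f g : S) : Prop :=
  match val s with
  | 0%N => cyc_rel121 f g
  | 1%N => let J1 := ideal3 (x1 ^+ l) (x2 ^+ m) (Qx3 * h) in J1 f /\ J1 g
  | _ => let J2 := ideal3 (x1 ^+ l) h (x2 ^+ m * Qx1) in J2 f /\ J2 g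
  end.

Lemma cyc_relD s f g f' g' :
  cyc_rel s f g -> cyc_rel s f' g' -> cyc_rel s (f + f') (g + g').
Proof.
elim/ord3P: s; rewrite /cyc_rel /=.
- move=> [a1 [a2 [a3 [a4 [a5 [c [-> ->]]]]]]] [b1 [b2 [b3 [b4 [b5 [d [->
  ->]]]]]]].
  exists (a1 + b1), (a2 + b2), (a3 + b3), (a4 + b4), (a5 + b5), (c + d).
  by split; rewrite ?Qx3E; ring.
- by move=> [? ?] [? ?]; split; apply: ideal3D.
- by move=> [? ?] [? ?]; split; apply: ideal3D.
Qed.

Lemma cyc_relZ s f g k : cyc_rel s f g -> cyc_rel s (k * f) (k * g).
Proof.
elim/ord3P: s; rewrite /cyc_rel /=.
- move=> [a1 [a2 [a3 [a4 [a5 [c [-> ->]]]]]]].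
  exists (k * a1), (k * a2), (k * a3), (k * a4), (k * a5), (k * c).
  by split; rewrite ?Qx3E; ring.
- by move=> [? ?]; split; apply: ideal3Z.
- by move=> [? ?]; split; apply: ideal3Z.
Qed.

Lemma cyc_rel0 s : cyc_rel s 0 0.
Proof.
have h0 u v w : ideal3 u v w 0 by exists 0, 0, 0; ring.
elim/ord3P: s; rewrite /cyc_rel //=.
by exists 0, 0, 0, 0, 0, 0; split; rewrite ?Qx3E; ring.
Qed.

Definition cyc_col s (A : T) := forall j, cyc_rel s (A 0 j) (A 1 j).

Definition cyc_mx (M : 'M[T]_3) := forall s t, cyc_col s (M s t).

Lemma mx2_mul_col a b c d (A : T) j :
  ((mx2 a b c d * A) 0 j = a * A 0 j + b * A 1 j) *
  ((mx2 a b c d * A) 1 j = c * A 0 j + d * A 1 j).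
Proof.
by split; rewrite mxE !big_ord_recl big_ord0 addr0 !mxE //=;
  congr (_ + _ * A _ _);
   apply: val_inj.
Qed.

Lemma cyc_col_mulr s (A B : T) : cyc_col s A -> cyc_col s (A * B).
Proof.
move=> JA j; have E k : (A * B) k j = B 0 j * A k 0 + B 1 j * A k 1.
  rewrite mxE !big_ord_recl big_ord0 addr0 !(mulrC (A _ _)).
  by congr (_ + B _ _ * A _ _); apply: val_inj.
by rewrite !E; apply: cyc_relD; apply: cyc_relZ.
Qed.

Lemma cyc_colD s (A B : T) : cyc_col s A -> cyc_col s B -> cyc_col s (A + B).
Proof. by move=> JA JB j; rewrite !mxE; apply: cyc_relD. Qed.

Lemma cyc_col_sum s n (F : 'I_n -> T) :
  (forall k, cyc_col s (F k)) -> cyc_col s (\sum_k F k).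
Proof.
move=> JF; elim/big_ind: _ => //; last exact: cyc_colD.
by move=> j; rewrite !mxE; apply: cyc_rel0.
Qed.

Lemma cyc_mxD M N : cyc_mx M -> cyc_mx N -> cyc_mx (M + N).
Proof. by move=> JM JN s t; rewrite mxE; apply: cyc_colD. Qed.

Lemma cyc_mx0 : cyc_mx 0.
Proof. by move=> s t j; rewrite !mxE; apply: cyc_rel0. Qed.

Lemma cyc_mx_mulr M N : cyc_mx M -> cyc_mx (M * N).
Proof.
by move=> JM s t; rewrite mxE; apply: cyc_col_sum => k; apply: cyc_col_mulr.
Qed.

Lemma ideal3_lin u v w f g a b :
  ideal3 u v w f -> ideal3 u v w g -> ideal3 u v w (a * f + b * g).
Proof. by move=> *; apply: ideal3D; apply: ideal3Z. Qed.

(** The witnesses come from the relation [Qx3E] between [Qx1], [Qx3] and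
    [Qdiff]. *)
Lemma cyc_rel_x k s f g : cyc_rel s f g -> forall (A : T) j,
  A 0 j = f -> A 1 j = g -> cyc_rel s ((x_block k s * A) 0 j) ((x_block k s *
    A) 1 j).
Proof.
elim/ord3P: s; rewrite /cyc_rel /=; last 2 first.
- move=> [Jf Jg] A j Af Ag; elim/ord3P: k;
  rewrite /x_block /= !mx2_mul_col Af Ag;
    by split; apply: ideal3_lin.
- move=> [Jf Jg] A j Af Ag; elim/ord3P: k;
  rewrite /x_block /= !mx2_mul_col Af Ag;
    by split; apply: ideal3_lin.
move=> [a1 [a2 [a3 [a4 [a5 [c [-> ->]]]]]]] A j Af Ag.
elim/ord3P: k; rewrite /x_block /= !mx2_mul_col Af Ag.
- exists (x1 * a1 - Qx1 * a2), (x3 * a2), (x1 * a3 - c), (x1 * a4 - a5).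
  by exists (x3 * a5), (x3 * c); split; rewrite ?Qx3E; ring.
- exists (x2 * a1), (x2 * a2), (x2 * a3), (x2 * a4), (x2 * a5), (x2 * c).
  by split; rewrite ?Qx3E; ring.
- exists (x3 * a1 + Qx1 * a2), (x1 * a2), (x3 * a3 + c), (x3 * a4 + a5).
  by exists (x1 * a5), (x1 * c); split; rewrite ?Qx3E; ring.
Qed.

Lemma cyc_rel_psi r s f g : cyc_rel (swap_block r s) f g -> forall (A : T) j,
  A 0 j = f -> A 1 j = g -> cyc_rel s ((psi_block r s * A) 0 j) ((psi_block r s
    * A) 1 j).
Proof.
move=> Jfg A j Af Ag; move: Jfg.
elim/ord2P: r; elim/ord3P: s;
  rewrite /psi_block /swap_block /cyc_rel /= !mx2_mul_col Af Ag.
- move=> [[a [b [c ->]]] [a' [b' [c' ->]]]]; rewrite Qx3E.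
  exists (Qx1 * a), a', (Qx1 * c - Qdiff * c'), b, b', (Qx3 * c').
  by rewrite Qx3E; split; rewrite ?Qx3E; ring.
- move=> [a1 [a2 [a3 [a4 [a5 [c [-> ->]]]]]]]; split.
    by exists (a1 - Qdiff * a2), (Qx1 * a4 - Qdiff * a5), a3; ring.
  by exists (Qx3 * a2), (Qx3 * a5), c; ring.
- by move=> [Jf Jg]; split; apply: ideal3_lin.
- move=> [[a [b [c ->]]] [a' [b' [c' ->]]]].
  by exists (Qx3 * a + Qdiff * a'), a', b, (Qx3 * c + Qdiff * c'), (Qx1 * c'),
    b'; split; rewrite ?Qx3E; ring.
- by move=> [Jf Jg]; split; apply: ideal3_lin.
- move=> [a1 [a2 [a3 [a4 [a5 [c [-> ->]]]]]]]; split.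
    by exists a1, (Qdiff * c + Qx3 * a3), a4; ring.
  by exists (Qx1 * a2), (Qx1 * c), a5; ring.
Qed.

Lemma cyc_mx_rho z M : cyc_mx M -> cyc_mx (rho z * M).
Proof.
elim/free_alg_ind: z M => [c|g|a b IHa IHb|a b IHa IHb] M JM.
- rewrite rho_c => s t; rewrite rho_scalar_row => j.
  have E k : ((i c)%:M * M s t) k j = i c * M s t k j.
    by rewrite [_ * _]mul_scalar_mx mxE.
  by rewrite !E; apply: cyc_relZ; apply: JM.
- rewrite rho_g => s t; case: g => [[r|k]|v]; rewrite /= monomial_mx_row => j.
  + by apply: (@cyc_rel_psi r s _ _ (JM (swap_block r s) t j)).
  + by apply: (@cyc_rel_x k s _ _ (JM s t j)).
  + case: (v == _); first by rewrite mul1r; apply: JM.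
    by rewrite mul0r !mxE; apply: cyc_rel0.
- by rewrite rmorphD mulrDl; apply: cyc_mxD; [apply: IHa | apply: IHb].
- by rewrite rmorphM -mulrA; apply: IHa; apply: IHb.
Qed.

(** The exponent is the level of the first color of block [s]. The columns
    contain [h] because of the off-diagonal entries: for instance
    [x1^l tau = tau x3^l - Q(x1, x2) h e]. *)
Lemma cyc_col_power s : cyc_col s (x_block o0 s ^+ (nth 0%N [:: l; m; l] s)).
Proof.
have x3E : x3 ^+ l = x1 ^+ l - (x1 - x3) * h.
  by rewrite hsumP ?opprB ?[_ + (_ - _)]addrC ?subrK //; apply: mulrC.
elim/ord3P: s; rewrite /x_block /=.
- move=> j; rewrite mx2_exp !mxE /=; case: (j == 0).
    by exists 1, 0, 0, 0, 0, 0; split; rewrite ?Qx3E; ring.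
  (* The witnesses express [(- Qx1 * h, x3 ^+ l)]. *)
  exists 0, 1, (- 1), 0, 0, (x3 - x1); rewrite x3E; split; rewrite ?Qx3E; ring.
- have -> : mx2 x2 0 0 x2 ^+ m = mx2 (x2 ^+ m) 0 0 (x2 ^+ m).
    by rewrite -!mx2_scalar rmorphXn.
  move=> j; rewrite !mxE /=; case: (j == 0); split.
  + by exists 0, 1, 0; ring.
  + by exists 0, 0, 0; ring.
  + by exists 0, 0, 0; ring.
  + by exists 0, 1, 0; ring.
- move=> j; rewrite mx2_exp !mxE /=; case: (j == 0); split.
  + by exists 1, 0, 0; ring.
  + by exists 0, 0, 0; ring.
  + by exists 0, (- 1), 0; ring.
  + by rewrite x3E; exists 1, (x3 - x1), 0; ring.
Qed.

Variable Lambda : wlat X.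
Hypothesis l_def : `|simple_coroot X i1 Lambda|%N = l.
Hypothesis m_def : `|simple_coroot X i2 Lambda|%N = m.

Local Notation H := (quiver_hecke Q 3 beta).
Local Notation pi := (QH_pi Q 3 beta).
Local Notation sc := (QH_scalar Q 3 beta).
Local Notation xx := (QH_x Q (n := 3) beta).
Local Notation psi := (QH_psi Q (n := 3) beta).
Local Notation e := (QH_e Q (n := 3) (beta := beta)).
Local Notation cpi := (cyc_pi Q 3 beta Lambda).

Lemma rho_well_defined a b : pi a = pi b -> rho a = rho b.
Proof.
move/quot_piE => ab; apply/eqP; rewrite -subr_eq0 -rmorphB; apply/eqP.
elim: {a b}(a - b) / ab => [z [a [b [ab ->]]]||a b _ IHa _ IHb|a b _ IHb|a b _
  IHa].
- by rewrite rmorphB (rho_rel ab) subrr.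
- by rewrite rmorph0.
- by rewrite rmorphD IHa IHb addr0.
- by rewrite rmorphM IHb mulr0.
- by rewrite rmorphM IHa mul0r.
Qed.

(** Lower bound for the quotient: an element of the cyclotomic ideal maps the
    whole representation into the submodule [cyc_rel]. *)
Lemma cyc_mx_ideal y : ideal_gen (@cyc_gen I C X K Q 3 beta Lambda) y ->
  forall z, pi z = y -> cyc_mx (rho z).
Proof.
elim => {y}[_ [v k k0]|z z0|y y' Iy IHy Iy' IHy' z zE|y y' Iy IHy z zE|y y' Iy
  IHy z zE].
- move=> z; rewrite /QH_x /QH_e -rmorphXn -rmorphM => /rho_well_defined ->.
  have -> : k = o0 by apply: val_inj.
  set n := `| _ |%N; rewrite rmorphM rmorphXn /gen_x /gen_e !rho_g => s t.
  have E p : ((rho_gen (inl (inr o0))) ^+ p *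
      rho_gen (inr v)) s t = x_block o0 s ^+ p * (rho_gen (inr v)) s t.
    elim: p => [|p IHp]; first by rewrite !expr0 !mul1r.
    by rewrite !exprS -!mulrA monomial_mx_row IHp.
  rewrite E {E} -[rho_gen (inr v)]mulr1 monomial_mx_row.
  have [vs|_] := eqVneq v (nu s); last first.
    by rewrite mul0r mulr0 => j; rewrite !mxE; apply: cyc_rel0.
  apply: cyc_col_mulr; have -> : n = nth 0%N [:: l; m; l] s.
    by rewrite /n vs color_nu; elim/ord3P: (s).
  exact: cyc_col_power.
- have /rho_well_defined -> : pi z = pi 0 by rewrite z0 rmorph0.
  by rewrite rmorph0; apply: cyc_mx0.
- have [[w yE] [w' yE']] := (quot_pi_surj y, quot_pi_surj y').
  have /rho_well_defined -> : pi z = pi (w + w') by rewrite zE yE yE' rmorphD.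
  by rewrite rmorphD; apply: cyc_mxD; [apply: IHy | apply: IHy'].
- have [[w yE] [w' yE']] := (quot_pi_surj y, quot_pi_surj y').
  have /rho_well_defined -> : pi z = pi (w * w') by rewrite zE yE yE' rmorphM.
  by rewrite rmorphM; apply: cyc_mx_rho; apply: IHy.
- have [[w yE] [w' yE']] := (quot_pi_surj y, quot_pi_surj y').
  have /rho_well_defined -> : pi z = pi (w * w') by rewrite zE yE yE' rmorphM.
  by rewrite rmorphM; apply: cyc_mx_mulr; apply: IHy.
Qed.

(** * Generators of the left module of e(121) *)
Lemma QH_relE a b : @QH_rel I C X K Q 3 beta a b -> pi a = pi b.
Proof. by move=> ab; apply/quot_piE; apply: ideal_in; exists a, b. Qed.

(** The defining relations are restated on elements of one block, where the
    idempotent is absorbed and the colors are known. *)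
Definition in_block s (y : H) := e (nu s) * y = y.

Lemma e_in_block v s y : in_block s y -> e v * y = (v == nu s)%:R * y.
Proof.
move=> ys; rewrite -{1}ys mulrA /QH_e -rmorphM (QH_relE (rel_e_e _ _ _)).
rewrite rmorphM rmorph_nat -mulrA; have [->|_] := eqVneq v (nu s).
  by rewrite [pi _ * _]ys.
by rewrite !mul0r.
Qed.

Lemma in_block_e s : in_block s (e (nu s)).
Proof.
by rewrite /in_block /QH_e -rmorphM (QH_relE (rel_e_e _ _ _)) eqxx mul1r.
Qed.

Lemma x_e k v : xx k * e v = e v * xx k.
Proof. by rewrite /QH_x /QH_e -!rmorphM (QH_relE (rel_x_e _ _ _)). Qed.

Lemma psi_e r s : psi r * e (nu s) = e (nu (swap_block r s)) * psi r.
Proof.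
by rewrite /QH_psi /QH_e -!rmorphM (QH_relE (rel_psi_e _ _ _)) nu_swap_block.
Qed.

Lemma in_block_psi r s y : in_block s y -> in_block (swap_block r s) (psi r *
  y).
Proof. by rewrite /in_block mulrA -psi_e -mulrA => ->. Qed.

Lemma xC k k' : xx k * xx k' = xx k' * xx k.
Proof. by rewrite /QH_x -!rmorphM (QH_relE (rel_x_x _ _ _ _)). Qed.

Definition same_color s (a b : nat) : bool :=
  nth i1 (block_word s) a == nth i1 (block_word s) b.

Lemma psi_x r s y : in_block s y ->
  psi r * (xx (@posS 3 r) * y)
    = xx (@pos 3 r) * (psi r * y) + (same_color s r r.+1)%:R * y.
Proof.
move=> ys; have := QH_relE (rel_psi_x Q r (nu s)); rewrite !color_nu.
rewrite !rmorphM rmorphD rmorphM rmorph_nat.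
by move=> h; rewrite -ys !mulrA -!mulrDl; congr (_ * y).
Qed.

Lemma x_psi r s y : in_block s y ->
  xx (@posS 3 r) * (psi r * y)
    = psi r * (xx (@pos 3 r) * y) + (same_color s r r.+1)%:R * y.
Proof.
move=> ys; have := QH_relE (rel_x_psi Q r (nu s)); rewrite !color_nu.
rewrite !rmorphM rmorphD rmorphM rmorph_nat.
by move=> h; rewrite -ys !mulrA -!mulrDl; congr (_ * y).
Qed.

Lemma psi_x_far r k y : k != @pos 3 r -> k != @posS 3 r ->
  xx k * (psi r * y) = psi r * (xx k * y).
Proof.
move=> k1 k2; rewrite !mulrA /QH_x /QH_psi -!rmorphM.
by rewrite (QH_relE (rel_psi_x_far _ _ k1 k2)).
Qed.

Lemma pi_eval2 p a b : pi (eval2 p a b) = ev2 sc p (pi a) (pi b).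
Proof. by rewrite eval2E rmorph_ev2. Qed.

Lemma psi_sq r s y : in_block s y ->
  psi r * (psi r * y) =
  ev2 sc (Q (nth i1 (block_word s) r) (nth i1 (block_word s) r.+1))
      (xx (@pos 3 r)) (xx (@posS 3 r)) * y.
Proof.
move=> ys; rewrite -ys !mulrA /QH_psi /QH_e -!rmorphM -expr2.
rewrite (QH_relE (rel_psi_sq _ _ _)) !color_nu rmorphM pi_eval2.
by [].
Qed.

Lemma braid s y : in_block s y ->
  psi r1 * (psi r0 * (psi r1 * y)) = psi r0 * (psi r1 * (psi r0 * y)) +
  (same_color s 0 2)%:R *
  (dd2 sc (Q (nth i1 (block_word s) 0) (nth i1 (block_word s) 1))
       (xx o0) (xx o1) (xx o2) * y).
Proof.
move=> ys; have := QH_relE (@rel_braid I C X K Q 3 beta r0 r1 (nu s) (erefl _)).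
rewrite !color_nu divdiffE !rmorphM rmorph_nat rmorph_dd2 rmorphB !rmorphM
  ?posE.
rewrite mulrBl => /(canRL (subrK _)) h.
rewrite -ys !mulrA -mulrDl; congr (_ * y); rewrite [RHS]addrC; exact: h.
Qed.

Variable ev : {rmorphism S -> H}.
Hypothesis ev_sc : forall k, ev (i k) = sc k.
Hypotheses (ev_x1 : ev x1 = xx o0) (ev_x2 : ev x2 = xx o1) (ev_x3 : ev x3 = xx
  o2).

(** The two generators of each block over the polynomial ring acting on the
    right through [ev]; [gen_tau o0] is [tau]. *)
Definition gen_one (s : 'I_3) : H :=
  match val s with
  | 0%N => e (nu o0)
  | 1%N => psi r0 * e (nu o0)
  | _ => psi r1 * e (nu o0)
  end.

Definition gen_tau (s : 'I_3) : H :=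
  match val s with
  | 0%N => psi r0 * (psi r1 * (psi r0 * e (nu o0)))
  | 1%N => psi r1 * (psi r0 * e (nu o0))
  | _ => psi r0 * (psi r1 * e (nu o0))
  end.

Lemma in_block_gens s : in_block s (gen_one s) /\ in_block s (gen_tau s).
Proof.
have b0 := in_block_e o0.
have b1 := in_block_psi r0 b0; have b2 := in_block_psi r1 b0.
have b3 := in_block_psi r1 b1; have b4 := in_block_psi r0 b2.
have b5 := in_block_psi r0 b3.
by elim/ord3P: s.
Qed.

(** The element with coordinates [v] on the generators of block [s]. *)
Definition Theta s (v : 'cV[S]_2) : H := gen_one s * ev (v 0 0) + gen_tau s *
  ev (v 1 0).

Lemma ThetaD s v w : Theta s (v + w) = Theta s v + Theta s w.
Proof. by rewrite /Theta !mxE !rmorphD !mulrDr addrACA. Qed.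

Lemma in_block_Theta s v : in_block s (Theta s v).
Proof.
have [bU bW] := in_block_gens s.
by rewrite /in_block /Theta mulrDr !mulrA bU bW.
Qed.

Lemma mx2_mul_cv a b c d (v : 'cV[S]_2) :
  ((mx2 a b c d *m v) 0 0 = a * v 0 0 + b * v 1 0) *
  ((mx2 a b c d *m v) 1 0 = c * v 0 0 + d * v 1 0).
Proof.
by split; rewrite mxE !big_ord_recl big_ord0 addr0 !mxE //=;
  congr (_ + _ * v _ _);
   apply: val_inj.
Qed.

(** Everything commutes with the right action of polynomials, so a left
    multiplication is known from its effect on the two generators. *)
Lemma Theta_lin z s s' a b c d :
    z * gen_one s = gen_one s' * ev a + gen_tau s' * ev c -> z * gen_tau s =
      gen_one s' * ev b + gen_tau s' * ev d ->
  forall v, z * Theta s v = Theta s' (mx2 a b c d *m v).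
Proof.
move=> zU zW v; rewrite /Theta !mx2_mul_cv mulrDr !mulrA zU zW.
by rewrite !rmorphD !rmorphM !mulrDr !mulrDl !mulrA addrACA.
Qed.

Lemma pos_psi r s y : in_block s y ->
  xx (@pos 3 r) * (psi r * y)
    = psi r * (xx (@posS 3 r) * y) - (same_color s r r.+1)%:R * y.
Proof. by move=> ys; rewrite (psi_x _ ys) addrK. Qed.

Let b0 := in_block_e o0.
Let b1 := in_block_psi r0 b0.
Let b2 := in_block_psi r1 b0.
Let b3 := in_block_psi r1 b1.
Let b4 := in_block_psi r0 b2.

Lemma same_color_word : (same_color o0 0 1 = false) * (same_color o0 1 2 =
  false)
  * (same_color o1 0 1 = false) * (same_color o1 1 2 = true)
  * (same_color o2 0 1 = true) * (same_color o2 1 2 = false).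
Proof.
by rewrite /same_color /= !eqxx [i2 == i1]eq_sym (negPf i12).
Qed.

Lemma x_psi0 s y : in_block s y -> same_color s 0 1 = false ->
  [/\ xx o0 * (psi r0 * y) = psi r0 * (xx o1 * y),
      xx o1 * (psi r0 * y) = psi r0 * (xx o0 * y)
    & xx o2 * (psi r0 * y) = psi r0 * (xx o2 * y)].
Proof.
move=> ys ne; split; last exact: psi_x_far.
- by have := pos_psi r0 ys; rewrite !posE ne mul0r subr0.
- by have := x_psi r0 ys; rewrite !posE ne mul0r addr0.
Qed.

Lemma x_psi1 s y : in_block s y -> same_color s 1 2 = false ->
  [/\ xx o0 * (psi r1 * y) = psi r1 * (xx o0 * y),
      xx o1 * (psi r1 * y) = psi r1 * (xx o2 * y)
    & xx o2 * (psi r1 * y) = psi r1 * (xx o1 * y)].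
Proof.
move=> ys ne; split; first exact: psi_x_far.
- by have := pos_psi r1 ys; rewrite !posE ne mul0r subr0.
- by have := x_psi r1 ys; rewrite !posE ne mul0r addr0.
Qed.

Lemma x_psi0_same s y : in_block s y -> same_color s 0 1 ->
  [/\ xx o0 * (psi r0 * y) = psi r0 * (xx o1 * y) - y,
      xx o1 * (psi r0 * y) = psi r0 * (xx o0 * y) + y
    & xx o2 * (psi r0 * y) = psi r0 * (xx o2 * y)].
Proof.
move=> ys eq; split; last exact: psi_x_far.
- by have := pos_psi r0 ys; rewrite !posE eq mul1r.
- by have := x_psi r0 ys; rewrite !posE eq mul1r.
Qed.

Lemma x_psi1_same s y : in_block s y -> same_color s 1 2 ->
  [/\ xx o0 * (psi r1 * y) = psi r1 * (xx o0 * y),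
      xx o1 * (psi r1 * y) = psi r1 * (xx o2 * y) - y
    & xx o2 * (psi r1 * y) = psi r1 * (xx o1 * y) + y].
Proof.
move=> ys eq; split; first exact: psi_x_far.
- by have := pos_psi r1 ys; rewrite !posE eq mul1r.
- by have := x_psi r1 ys; rewrite !posE eq mul1r.
Qed.

Lemma ev_e f g a : ev2 sc f (xx g) (xx a) * e (nu o0) = e (nu o0) * ev2 sc f
  (xx g) (xx a).
Proof.
apply: (@rel_ev2 K _ _ (fun (y z : H) => y * e (nu o0) = e (nu o0) * z));
  rewrite ?x_e //.
- by rewrite mul0r mulr0.
- by rewrite mul1r mulr1.
- by move=> ? ? ? ? h h'; rewrite mulrDl mulrDr h h'.
- by move=> ? ? ? ? h h'; rewrite -mulrA h' !mulrA h.
- by move=> k; apply: QH_scalar_central.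
Qed.

Lemma ev_Qx1 : ev Qx1 = ev2 sc q (xx o0) (xx o1).
Proof. by rewrite rmorph_ev2 ev_x1 ev_x2; apply: eq_ev2 => k; apply: ev_sc. Qed.

Lemma ev_Qx3 : ev Qx3 = ev2 sc q (xx o2) (xx o1).
Proof. by rewrite rmorph_ev2 ev_x3 ev_x2; apply: eq_ev2 => k; apply: ev_sc. Qed.

Lemma ev_Qdiff : ev Qdiff = dd2 sc q (xx o0) (xx o1) (xx o2).
Proof.
by rewrite rmorph_dd2 ev_x1 ev_x2 ev_x3; apply: eq_dd2 => k; apply: ev_sc.
Qed.

Lemma psi00_e : psi r0 * (psi r0 * e (nu o0)) = e (nu o0) * ev Qx1.
Proof. by rewrite (psi_sq r0 b0) ev_Qx1 -ev_e !posE. Qed.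

(** Block [211], then block [112], and block [121] last because [tau] is [psi1]
    times the second generator of block [211]. *)
Lemma Theta_x1 k v : xx k * Theta o1 v = Theta o1 (x_block k o1 *m v).
Proof.
have [A0 A1 A2] := x_psi0 b0 (same_color_word).1.1.1.1.1.
have [B0 B1 B2] := x_psi1_same b1 (same_color_word).1.1.2.
elim/ord3P: k; apply: Theta_lin;
  rewrite /gen_one /gen_tau /= ?A0 ?A1 ?A2 ?B0 ?B1 ?B2.
all: rewrite ?A0 ?A1 ?A2 ?x_e ?rmorphN ?rmorph0 ?rmorph1 ?ev_x1 ?ev_x2 ?ev_x3.
all: rewrite ?mulr0 ?mulr1 ?mulrN1 ?addr0 ?add0r !mulrA //.
all: exact: addrC.
Qed.

Lemma Theta_x2 k v : xx k * Theta o2 v = Theta o2 (x_block k o2 *m v).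
Proof.
have [A0 A1 A2] := x_psi1 b0 (same_color_word).1.1.1.1.2.
have [B0 B1 B2] := x_psi0_same b2 (same_color_word).1.2.
elim/ord3P: k; apply: Theta_lin;
  rewrite /gen_one /gen_tau /= ?A0 ?A1 ?A2 ?B0 ?B1 ?B2.
all: rewrite ?A0 ?A1 ?A2 ?x_e ?rmorphN ?rmorph0 ?rmorph1 ?ev_x1 ?ev_x2 ?ev_x3.
all: rewrite ?mulr0 ?mulr1 ?mulrN1 ?addr0 ?add0r !mulrA //.
all: exact: addrC.
Qed.

Lemma Theta_x0 k v : xx k * Theta o0 v = Theta o0 (x_block k o0 *m v).
Proof.
have [A0 A1 A2] := x_psi0 b0 (same_color_word).1.1.1.1.1.
have [B0 B1 B2] := x_psi1_same b1 (same_color_word).1.1.2.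
have [C0 C1 C2] := x_psi0 b3 (same_color_word).1.1.1.2.
elim/ord3P: k; apply: Theta_lin;
  rewrite /gen_one /gen_tau /= ?C0 ?C1 ?C2 ?B0 ?B1 ?B2.
all: rewrite ?A0 ?A1 ?A2 ?mulrBr ?mulrDr ?psi00_e.
all: rewrite ?x_e ?rmorphN ?rmorph0 ?rmorph1 ?ev_x1 ?ev_x2 ?ev_x3.
all: rewrite ?mulr0 ?mulr1 ?mulrN ?addr0 ?add0r ?mulrA //.
all: exact: addrC.
Qed.

Lemma Theta_x k s v : xx k * Theta s v = Theta s (x_block k s *m v).
Proof.
elim/ord3P: s v => v; [exact: Theta_x0|exact: Theta_x1|exact: Theta_x2].
Qed.

Lemma Theta_scalar c s v : sc c * Theta s v = Theta s ((i c)%:M *m v).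
Proof.
rewrite mx2_scalar; apply: Theta_lin; rewrite ev_sc rmorph0 mulr0.
  by rewrite addr0 QH_scalar_central.
by rewrite add0r QH_scalar_central.
Qed.

Lemma Theta_ev2 p s k k' v : ev2 sc p (xx k) (xx k') * Theta s v =
  Theta s (ev2 (fun c => (i c)%:M) p (x_block k s) (x_block k' s) *m v).
Proof.
move: v; apply: (@rel_ev2 K _ _ (fun (y : H) (A : T) =>
  forall v, y * Theta s v = Theta s (A *m v))).
- by move=> v; rewrite mul0r mul0mx /Theta !mxE rmorph0 !mulr0 addr0.
- by move=> v; rewrite mul1r mul1mx.
- by move=> y z A B yA zB v; rewrite mulrDl yA zB mulmxDl ThetaD.
- by move=> y z A B yA zB v; rewrite -mulrA zB yA mulmxA.
- by move=> c v; apply: Theta_scalar.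
- by move=> v; apply: Theta_x.
- by move=> v; apply: Theta_x.
Qed.

Lemma Theta_one s (v : 'cV[S]_2) : v 0 0 = 1 -> v 1 0 = 0 -> Theta s v =
  gen_one s.
Proof. by rewrite /Theta => -> ->;
  rewrite rmorph0 rmorph1 mulr1 mulr0 addr0. Qed.

Lemma ev2_sc_swap p k k' : ev2 sc (swapXY p) (xx k) (xx k') = ev2 sc p (xx k')
  (xx k).
Proof. by apply: ev2_swap; apply: xC. Qed.

Lemma dd_e : dd2 sc q (xx o0) (xx o1) (xx o2) * e (nu o0)
  = e (nu o0) * dd2 sc q (xx o0) (xx o1) (xx o2).
Proof.
apply: (@rel_dd2 K _ _ (fun (y z : H) => y * e (nu o0) = e (nu o0) * z));
  rewrite ?x_e //.
- by rewrite mul0r mulr0.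
- by rewrite mul1r mulr1.
- by move=> ? ? ? ? h h'; rewrite mulrDl mulrDr h h'.
- by move=> ? ? ? ? h h'; rewrite -mulrA h' !mulrA h.
- by move=> k; apply: QH_scalar_central.
Qed.

(** The product [psi1 tau] is [psi1^2] times the second generator of block
    [211], and [psi1^2] is a polynomial in [x1] and [x2], whose action on that
    block is already known. *)
Lemma psi0_gen_tau : psi r0 * gen_tau o0 = gen_one o1 * ev (- Qdiff) + gen_tau
  o1 * ev Qx3.
Proof.
have -> : psi r0 * gen_tau o0 = psi r0 * (psi r0 * gen_tau o1) by [].
rewrite (psi_sq r0 b3) !posE /= Q21 ev2_sc_swap.
pose v : 'cV[S]_2 := \col_k (k == 1)%:R.
have -> : psi r1 * (psi r0 * e (nu o0)) = Theta o1 v.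
  by rewrite /Theta !mxE /= rmorph0 rmorph1 mulr0 mulr1 add0r.
rewrite Theta_ev2 /x_block /= mx2_x2 ev2_12 /Theta !mx2_mul_cv !mxE /=.
by rewrite !mulr0 !mulr1 !add0r mulN1r.
Qed.

Lemma Theta_psi r s v :
  psi r * Theta s v = Theta (swap_block r s) (psi_block r (swap_block r s) *m
    v).
Proof.
elim/ord2P: r; elim/ord3P: s; apply: Theta_lin; rewrite ?psi0_gen_tau //.
all: rewrite ?rmorph0 ?rmorph1 ?mulr0 ?mulr1 ?addr0 ?add0r //.
- exact: psi00_e.
- by rewrite /gen_tau /= (psi_sq r0 b2) /= Qd ev2_poly0 mul0r.
- rewrite /gen_tau /= (braid b1) /same_color /= [i2 == i1]eq_sym (negPf i12).
  by rewrite mul0r addr0 psi00_e !mulrA.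
- by rewrite /gen_tau /= (psi_sq r1 b1) /= Qd ev2_poly0 mul0r.
- by rewrite /gen_one /= (psi_sq r1 b0) /= Q21 ev2_sc_swap !posE ev_e ev_Qx3.
- rewrite /gen_tau /= (braid b0) /same_color /= eqxx mul1r dd_e ev_Qdiff.
  exact: addrC.
Qed.

Lemma Theta_e v s w : e v * Theta s w = (v == nu s)%:R * Theta s w.
Proof. exact/e_in_block/in_block_Theta. Qed.

(** Sums up the column of [e(121)]: since [Psi 1 = e(121)], this map shows that
    [z * e(121)] has the coordinates given by [rho z]. *)
Definition Psi (M : 'M[T]_3) : H := \sum_s Theta s (col 0 (M s o0)).

Lemma col0_mul (A B : T) : col 0 (A * B) = A *m col 0 B.
Proof. by apply/matrixP => k k'; rewrite !mxE; apply: eq_bigr => t _;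
  rewrite !mxE. Qed.

Lemma col0_add (M N : 'M[T]_3) s t :
  col 0 ((M + N) s t) = col 0 (M s t) + col 0 (N s t).
Proof. by apply/matrixP => k k'; rewrite !mxE. Qed.

Lemma Theta0 s : Theta s 0 = 0.
Proof. by rewrite /Theta !mxE rmorph0 !mulr0 addr0. Qed.

Lemma Psi_rho z M : Psi (rho z * M) = pi z * Psi M.
Proof.
elim/free_alg_ind: z M => [c|g|a b IHa IHb|a b IHa IHb] M.
- rewrite rho_c /Psi mulr_sumr; apply: eq_bigr => s _.
  by rewrite rho_scalar_row col0_mul -Theta_scalar.
- rewrite rho_g; case: g => [[r|k]|v]; rewrite /Psi mulr_sumr.
  + rewrite [RHS](reindex_inj (inv_inj (swap_blockK r))); apply: eq_bigr => s _.
    by rewrite monomial_mx_row col0_mul [RHS]Theta_psi swap_blockK.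
  + by apply: eq_bigr => s _; rewrite monomial_mx_row col0_mul [RHS]Theta_x.
  + apply: eq_bigr => s _; rewrite monomial_mx_row [RHS]Theta_e.
    case: (v == nu s); first by rewrite !mul1r.
    by rewrite !mul0r col0 Theta0.
- rewrite !rmorphD !mulrDl -IHa -IHb /Psi -big_split; apply: eq_bigr => s _.
  by rewrite col0_add ThetaD.
- by rewrite !rmorphM -!mulrA IHa IHb.
Qed.

Lemma Psi1 : Psi 1 = e (nu o0).
Proof.
rewrite /Psi (bigD1 o0) //= big1 ?addr0; last first.
  move=> s /negPf s0; rewrite mxE s0 (_ : col _ _ = 0) ?Theta0 //.
  by apply/matrixP => ? ?; rewrite !mxE.
by rewrite Theta_one // !mxE.
Qed.

(** The elements [e f + tau g] fill up the algebra [e R(beta) e], and the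
    coordinates are read off the representation. *)
Lemma sandwich_121 z : e (nu o0) * pi z * e (nu o0) =
  e (nu o0) * ev (rho z o0 o0 0 0) + gen_tau o0 * ev (rho z o0 o0 1 0).
Proof.
rewrite -mulrA -Psi1 -Psi_rho mulr1 Psi1 /Psi mulr_sumr (bigD1 o0) //=.
rewrite big1 ?addr0; last first.
  move=> s /negPf s0; rewrite Theta_e.
  by rewrite (inj_eq nu_inj) eq_sym s0 mul0r.
by rewrite Theta_e eqxx mul1r /Theta !mxE.
Qed.

(** * Relations in the cyclotomic quotient *)
Definition cv (f g : S) : 'cV[S]_2 := \col_k if k == 0 then f else g.

Lemma mx2_cv a b c d f g :
  mx2 a b c d *m cv f g = cv (a * f + b * g) (c * f + d * g).
Proof.
have o2E (k : 'I_2) : k = 0 \/ k = 1 by case: k => [[|[|]]] // ?;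
  [left|right]; apply: val_inj.
apply/matrixP => k j; rewrite (ord1 j).
by case: (o2E k) => ->; rewrite mx2_mul_cv !mxE.
Qed.

(** The next lemmas give the upper bound for the quotient. The known elements of
    the kernel are the multiples of [x1 ^+ l] or [x1 ^+ m] in each block; left
    multiplication by [psi] brings them to block [121]. *)
Definition killed s f g := cpi (Theta s (cv f g)) = 0.

Lemma killed_psi r s f g : killed s f g ->
  cpi (Theta (swap_block r s) (psi_block r (swap_block r s) *m cv f g)) = 0.
Proof.
move=> kfg; rewrite -Theta_psi rmorphM.
by rewrite [cpi (Theta _ _)]kfg mulr0.
Qed.

Lemma killed_cyc s f g :
  cpi (Theta s (x_block o0 s ^+ nth 0%N [:: l; m; l] s *m cv f g)) = 0.
Proof.
set n := nth _ _ _.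
have -> : Theta s (x_block o0 s ^+ n *m cv f g) = xx o0 ^+ n * e (nu s) * Theta
  s (cv f g).
  rewrite -mulrA (in_block_Theta s (cv f g)).
  elim: n => [|n IHn]; first by rewrite !expr0 mul1r mul1mx.
  rewrite !exprS -mulmxA -Theta_x IHn.
  by rewrite mulrA.
rewrite rmorphM; suff -> : cpi (xx o0 ^+ n * e (nu s)) = 0 by rewrite mul0r.
apply/quot_pi_eq0/ideal_in.
have -> : n = `|simple_coroot X (color (nu s) o0) Lambda|%N.
  by rewrite color_nu /n; elim/ord3P: (s) => /=.
by constructor.
Qed.

Lemma killedD s f g f' g' : killed s f g -> killed s f' g' ->
  killed s (f + f') (g + g').
Proof.
rewrite /killed => k k'.
have -> : cv (f + f') (g + g') = cv f g + cv f' g'.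
  by apply/matrixP => t j; rewrite !mxE; case: (t == 0).
by rewrite ThetaD rmorphD k k' addr0.
Qed.

Lemma killedM s f g c : killed s f g -> killed s (f * c) (g * c).
Proof.
rewrite /killed => k.
have -> : Theta s (cv (f * c) (g * c)) = Theta s (cv f g) * ev c.
  by rewrite /Theta !mxE /= !rmorphM mulrDl !mulrA.
by rewrite rmorphM k mul0r.
Qed.

Lemma killed_x1l : killed o0 (x1 ^+ l) 0.
Proof.
have := killed_cyc o0 1 0; rewrite /x_block /= mx2_exp mx2_cv.
by rewrite !(mulr1, mulr0, mul0r, addr0, add0r).
Qed.

Lemma killed_x3l : killed o0 (- Qx1 * h) (x3 ^+ l).
Proof.
have := killed_cyc o0 0 1; rewrite /x_block /= mx2_exp mx2_cv.
by rewrite !(mulr1, mulr0, mul0r, addr0, add0r).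
Qed.

Lemma killed_tau_x1l : killed o0 0 (x1 ^+ l).
Proof.
have := killed_psi r0 killed_x1l;
  rewrite /psi_block /swap_block /= mx2_cv => k1.
have := @killed_psi r1 o1 _ _ k1;
  rewrite /psi_block /swap_block /= mx2_cv => k2.
have := @killed_psi r0 o1 _ _ k2; rewrite /psi_block /swap_block /= mx2_cv.
by rewrite !(mulr0, mul0r, mul1r, addr0, add0r).
Qed.

Lemma killed_211 : killed o1 (x2 ^+ m) 0.
Proof.
have := killed_cyc o1 1 0;
  rewrite /x_block /= mx2_x2 -rmorphXn /= mx2_scalar mx2_cv.
by rewrite !(mulr1, mulr0, mul0r, addr0, add0r).
Qed.

(** This is [psi1 x1^m psi1 e]. *)
Lemma killed_x2m : killed o0 (x2 ^+ m * Qx1) 0.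
Proof.
have := @killed_psi r0 o1 _ _ killed_211;
  rewrite /psi_block /swap_block /= mx2_cv.
by rewrite !(mulr0, mul0r, mul1r, addr0, add0r) mulrC.
Qed.

(** This is [psi1 psi2 x1^m psi1 e]. *)
Lemma killed_tau_x2m : killed o0 0 (x2 ^+ m).
Proof.
have := @killed_psi r1 o1 _ _ killed_211;
  rewrite /psi_block /swap_block /= mx2_cv => k2.
have := @killed_psi r0 o1 _ _ k2; rewrite /psi_block /swap_block /= mx2_cv.
by rewrite !(mulr0, mul0r, mul1r, addr0, add0r).
Qed.

(** Up to sign this is [psi2 psi1 x1^l psi1 psi2 e]. *)
Lemma killed_Dh : killed o0 (Qdiff * h) h.
Proof.
have k0 : killed o2 (- h) (x3 ^+ l).
  have := killed_cyc o2 0 1; rewrite /x_block /= mx2_exp mx2_cv.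
  by rewrite !(mulr1, mulr0, mul0r, addr0, add0r) mulN1r.
have := @killed_psi r0 o2 _ _ k0;
  rewrite /psi_block /swap_block /= mx2_cv => k1.
have := @killed_psi r1 o2 _ _ k1; rewrite /psi_block /swap_block /= mx2_cv.
rewrite !(mulr0, mul0r, mul1r, addr0, add0r) => k2.
by have := killedM (- 1) k2; rewrite !mulrN1 mulrN !opprK.
Qed.

(** Multiplying [(Qdiff * h, h)] by [x1 - x3] gives
    [((Qx1 - Qx3) * h, x1 ^+ l - x3 ^+ l)]; the other two terms are known. *)
Lemma killed_Qx3h : killed o0 (Qx3 * h) 0.
Proof.
have k1 := killedD (killedM (x1 - x3) killed_Dh) killed_x3l.
have k2 := killedM (- 1) (killedD k1 (killedM (- 1) killed_tau_x1l)).
have hE : h * (x1 - x3) = x1 ^+ l - x3 ^+ l by rewrite mulrC hsumP // mulrC.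
move: k2; rewrite hE Qx3E.
rewrite [X in killed o0 X _](_ : _ = (Qx1 - (x1 - x3) * Qdiff) * h);
  last by ring.
by rewrite [X in killed o0 _ X](_ : _ = 0); last by ring.
Qed.

Lemma killed_rel121 f g : cyc_rel121 f g -> killed o0 f g.
Proof.
move=> [a1 [a2 [a3 [a4 [a5 [c [-> ->]]]]]]].
have k := killedD (killedD (killedM a1 killed_x1l) (killedM a4 killed_x2m))
  (killedD (killedM c killed_Dh) (killedM a3 killed_Qx3h)).
have {}k := killedD k (killedD (killedM a2 killed_tau_x1l) (killedM a5
  killed_tau_x2m)).
by rewrite /killed -k; congr (cpi (Theta o0 (cv _ _))); ring.
Qed.

(** * The words of the basis *)
Definition mon3 (k : nat * nat * nat) : S := x1 ^+ k.1.1 * x2 ^+ k.1.2 * x3 ^+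
  k.2.

Lemma ev_mon_e k : ev (mon3 k) * e (nu o0) = e (nu o0) * ev (mon3 k).
Proof.
have xe t n : GRing.comm (e (nu o0)) (xx t ^+ n) by apply/commrX/esym/x_e.
rewrite /mon3 !rmorphM !rmorphXn /= ev_x1 ev_x2 ev_x3.
by apply/esym; apply: commrM; first apply: commrM.
Qed.

(** The index [(b, k)] stands for the monomial [x^k] times [e] if [b] is true,
    and times [tau] if [b] is false. *)
Definition basis_vec (k : bool * (nat * nat * nat)) : 'cV[S]_2 :=
  if k.1 then cv (mon3 k.2) 0 else cv 0 (mon3 k.2).

Definition mon_word (k : nat * nat * nat) : F :=
  gx o0 ^+ k.1.1 * gx o1 ^+ k.1.2
  * gx o2 ^+ k.2 * ge (nu o0).

Definition basis_word (k : bool * (nat * nat * nat)) : F :=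
  if k.1 then mon_word k.2 else
  gpsi r0 * (gpsi r1
     * (gpsi r0 * mon_word k.2)).

Lemma pi_mon_word k : pi (mon_word k) = e (nu o0) * ev (mon3 k).
Proof.
rewrite -ev_mon_e /mon_word /mon3 !rmorphM !rmorphXn /= ev_x1 ev_x2 ev_x3.
by [].
Qed.

Lemma pi_basis_word k : pi (basis_word k) = Theta o0 (basis_vec k).
Proof.
case: k => [[] k]; rewrite /basis_word /basis_vec /Theta !mxE /= rmorph0.
  by rewrite mulr0 addr0 pi_mon_word.
rewrite mulr0 add0r.
  transitivity (psi r0 * (psi r1 * (psi r0 * pi (mon_word k)))).
    by rewrite /QH_psi -!rmorphM.
by rewrite pi_mon_word /gen_tau /= !mulrA.
Qed.

Lemma basis_word_sandwich k :
  e (nu o0) * pi (basis_word k) * e (nu o0) = pi (basis_word k).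
Proof.
rewrite {1}pi_basis_word (in_block_Theta o0 (basis_vec k)) -pi_basis_word.
have ee : pi (mon_word k.2) * e (nu o0) = pi (mon_word k.2).
  by rewrite pi_mon_word -ev_mon_e -mulrA (in_block_e o0).
case: k ee => [[] k] /= ee; rewrite /basis_word //=.
transitivity (psi r0 * (psi r1 * (psi r0 * (pi (mon_word k) * e (nu o0))))).
  by rewrite /QH_psi !mulrA -!rmorphM !mulrA.
by rewrite ee /QH_psi -!rmorphM.
Qed.

Lemma rho_xpow k n M s t : (rho (gx k ^+ n) * M) s t
  = x_block k s ^+ n * M s t.
Proof.
elim: n => [|n IHn]; first by rewrite !expr0 rmorph1 !mul1r.
by rewrite !exprS rmorphM -!mulrA rho_x IHn.
Qed.

Lemma triangular_pow (a b d f : S) n :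
  mx2 a b 0 d ^+ n *m cv f 0 = cv (a ^+ n * f) 0.
Proof.
elim: n => [|n IHn]; first by rewrite !expr0 mul1mx mul1r.
rewrite exprS -mulmxA IHn mx2_cv exprS; congr cv; ring.
Qed.

Lemma rho_mon_word k : col 0 (rho (mon_word k) o0 o0) = cv (mon3 k) 0.
Proof.
rewrite /mon_word !rmorphM -!mulrA !rho_xpow -[rho (gen_e _ _)]mulr1.
rewrite rho_e eqxx mul1r !mxE eqxx !col0_mul /x_block /=.
have -> : col 0 (1 : 'M[S]_2) = cv 1 0.
  by apply/matrixP => t j; rewrite !mxE; case: (t == 0).
by rewrite !triangular_pow /mon3 mulr1 !mulrA.
Qed.

Lemma rho_basis_word k : col 0 (rho (basis_word k) o0 o0) = basis_vec k.
Proof.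
case: k => [[] k]; rewrite /basis_word /basis_vec /=; first exact: rho_mon_word.
set u := gen_psi _ _ _; set v := gen_psi _ _ _.
have -> : rho (u * (v * (u * mon_word k)))
    = rho u * (rho v * (rho u * rho (mon_word k))) by rewrite -!rmorphM.
rewrite !rho_psi /swap_block /= !col0_mul rho_mon_word /psi_block /= !mx2_cv.
by congr cv; ring.
Qed.

Lemma rho_scaled c z : col 0 (rho (c *: z) o0 o0) = i c *: col 0 (rho z o0 o0).
Proof.
rewrite -mulr_algl rmorphM rho_c rho_scalar_row col0_mul.
by rewrite mul_scalar_mx.
Qed.

Lemma Theta_scaled c f g : Theta o0 (cv (i c * f) (i c * g)) = c *: Theta o0
  (cv f g).
Proof.
rewrite QH_scaleE Theta_scalar mul_scalar_mx; congr (Theta o0 _).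
by apply/matrixP => t j; rewrite !mxE; case: (t == 0).
Qed.

Lemma Theta_sub f g f' g' :
  Theta o0 (cv (f - f') (g - g')) = Theta o0 (cv f g) - Theta o0 (cv f' g').
Proof. by rewrite /Theta !mxE /= !rmorphB !mulrBr opprD addrACA. Qed.

(** The representation sends a word of the basis to its coordinates, so a linear
    relation in the cyclotomic quotient becomes a pair of [rel121]. *)
Lemma relation_rel121 (L : Type) (s : seq L) (c : L -> K) code :
  \sum_(t <- s) c t *: cpi (pi (basis_word (code t))) = 0 ->
  cyc_rel121
    (\sum_(t <- s) i (c t) * basis_vec (code t) 0 0)
    (\sum_(t <- s) i (c t) * basis_vec (code t) 1 0).
Proof.
move=> e0; pose z := \sum_(t <- s) c t *: basis_word (code t).
have z0 : ideal_gen (@cyc_gen I C X K Q 3 beta Lambda) (pi z).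
  apply/quot_pi_eq0; rewrite -[RHS]e0 /z !rmorph_sum; apply: eq_bigr => t _.
  by rewrite -cyc_piZ -QH_piZ.
have /(_ o0 o0 0) Jz :=
  cyc_mx_ideal z0 (erefl (pi z)).
have Ez k : rho z o0 o0 k 0 = \sum_(t <- s) i (c t) * basis_vec (code t) k 0.
  rewrite /z rmorph_sum !summxE; apply: eq_bigr => t _.
  have := congr1 (fun v : 'cV[S]_2 => v k 0) (rho_scaled (c t) (basis_word
    (code t))).
  by rewrite rho_basis_word !mxE.
by rewrite -!Ez.
Qed.

End Representation.

(** * Degrees and leading coefficients of Q *)
Section Qcoefficients.
Variables (I : choiceType) (C : cartan_datum I) (X : realization C).
Variables (K : fieldType) (Q : I -> I -> {poly {poly K}}).
Hypothesis hQ : QH_param X Q.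
Variables (i1 i2 : I).
Hypothesis i12 : i1 != i2.
Local Notation a := `|cartan C i1 i2|%N.
Local Notation b := `|cartan C i2 i1|%N.
Local Notation q := (Q i1 i2).
Local Notation d1 := (symmetrizer C i1).
Local Notation d2 := (symmetrizer C i2).

Lemma i21 : i2 != i1. Proof. by rewrite eq_sym. Qed.

Lemma cartan_absE : (d1 * a = d2 * b)%N.
Proof.
have := symmetrizerP C i1 i2.
have := cartan_le0 C i12; have := cartan_le0 C i21.
move: (cartan C i1 i2) (cartan C i2 i1) => u v; lia.
Qed.

(** The form evaluates to [2 d_i] on the squares and to [d_1 a_12] on the mixed
    term, so an exponent [(p, k)] of [Q] satisfies [p d_1 + k d_2 = - d_1 a_12].
    The right-hand side is also [- d_2 a_21], so that [Q] has degree [- a_12] in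
    the first variable, [- a_21] in the second one, and its leading terms are
    pure powers. *)
Lemma Q_homog p k : q`_p`_k != 0 -> (p * d1 + k * d2 = d1 * a)%N.
Proof.
move=> /(QH_homog hQ i12); rewrite !form_root !cartan_diag.
rewrite -(symmetrizerP C i1 i2).
have := cartan_le0 C i12; move: (cartan C i1 i2) => u u0 e.
have : (p%:Z * (d1%:Z * 2) + k%:Z * (d2%:Z * 2) + 2 * (d1%:Z * u))%:~R = 0 :>
  rat.
  by rewrite !rmorphD !rmorphM /= in e *; rewrite -[RHS]e.
by move/eqP; rewrite intr_eq0 => /eqP; lia.
Qed.

Lemma Q_coef_bound p k : q`_p`_k != 0 -> (p <= a)%N /\ (k <= b)%N.
Proof.
move=> /Q_homog; have := cartan_absE.
have := symmetrizer_gt0 C i1; have := symmetrizer_gt0 C i2.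
move: a b d1 d2 => u v s t ? ? ? ?; nia.
Qed.

Lemma Q_coef_top p k : q`_p`_k != 0 ->
  (p = a -> k = 0%N) /\ (k = b -> p = 0%N).
Proof.
move=> /Q_homog; have := cartan_absE.
have := symmetrizer_gt0 C i1; have := symmetrizer_gt0 C i2.
move: a b d1 d2 => u v s t ? ? ? ?; split=> ?; subst; nia.
Qed.

Definition t12 := q`_a`_0.
Definition t21 := q`_0`_b.

Lemma t12_neq0 : t12 != 0. Proof. exact: QH_lead hQ _ _ i12. Qed.
Lemma t21_neq0 : t21 != 0.
Proof. by rewrite /t21 (QH_sym hQ i12) coef_swapXY;
  apply: QH_lead hQ _ _ i21. Qed.

Lemma Q21_swap : Q i2 i1 = swapXY q.
Proof. exact: QH_sym hQ _ _ i21. Qed.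

Definition const3 : {rmorphism K -> {poly {poly {poly K}}}} :=
  polyC \o (polyC \o polyC).
Local Notation x1 := ('X%:P%:P : {poly {poly {poly K}}}).
Local Notation x2 := ('X%:P : {poly {poly {poly K}}}).
Local Notation x3 := ('X : {poly {poly {poly K}}}).

Lemma ev2_self (p : {poly {poly K}}) : p = ev2 (fun k => k%:P%:P) p 'X 'X%:P.
Proof.
rewrite [LHS]poly_expand; apply: eq_bigr => m _.
rewrite [X in X%:P]poly_expand rmorph_sum mulr_suml; apply: eq_bigr => k _.
by rewrite rmorphM rmorphXn /= -mulrA [_ ^+ k * _]mulrC.
Qed.

(** [Q(x1, x2)] as a polynomial in [x2] over [K[x1]]. The outer variable of [Q]
    is its first argument, hence the exchange. *)
Definition Qx1_poly : {poly {poly K}} := swapXY q.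

Lemma Qx1E : Qx1 Q i1 i2 const3 x1 x2 = Qx1_poly%:P.
Proof.
transitivity ((polyC \o @swapXY K) (ev2 (fun k => k%:P%:P) q 'X 'X%:P)).
  rewrite rmorph_ev2 /= swapXY_X swapXY_Y; apply: eq_ev2 => k /=.
  by rewrite swapXY_polyC map_polyC.
by rewrite -ev2_self.
Qed.

Lemma size_Qx1_poly : (size Qx1_poly <= b.+1)%N.
Proof.
apply/leq_sizeP => k bk; apply/polyP => p; rewrite coef_swapXY coef0.
by apply/eqP; apply: contraTT bk => /Q_coef_bound[_]; rewrite -leqNgt.
Qed.

Lemma Qx1_poly_top : t21^-1%:P * Qx1_poly`_b = 1.
Proof.
have -> : Qx1_poly`_b = t21%:P.
  apply/polyP => p; rewrite coef_swapXY coefC; case: p => [|p] //=.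
  by apply/eqP; apply/negPn/negP => /Q_coef_top[_ /(_ (erefl _))].
by rewrite -rmorphM mulVf ?t21_neq0.
Qed.

Lemma Qx3_map : Qx3 Q i1 i2 const3 x2 x3 = map_poly (map_poly polyC) q.
Proof.
transitivity (map_poly (map_poly (@polyC K)) (ev2 (fun k => k%:P%:P) q 'X
  'X%:P)).
  rewrite rmorph_ev2 /= map_polyX map_polyC /= map_polyX; apply: eq_ev2 => k /=.
  by rewrite !map_polyC /= map_polyC.
by rewrite -ev2_self.
Qed.

Lemma size_Qx3 : (size (Qx3 Q i1 i2 const3 x2 x3) <= a.+1)%N.
Proof.
rewrite Qx3_map (leq_trans (size_poly _ _)) //.
apply/leq_sizeP => p ap; apply/polyP => k; rewrite coef0.
by apply/eqP; apply: contraTT ap => /Q_coef_bound[]; rewrite -leqNgt.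
Qed.

Lemma Qx3_lead : (Qx3 Q i1 i2 const3 x2 x3)`_a = t12%:P%:P.
Proof.
rewrite Qx3_map coef_map /=; apply/polyP => k; rewrite coef_map coefC /=.
case: k => [|k] //=; rewrite (_ : q`_a`_k.+1 = 0) ?rmorph0 //.
by apply/eqP; apply/negPn/negP => /Q_coef_top[/(_ (erefl _))].
Qed.

Local Notation Qdiff := (Qdiff Q i1 i2 const3 x1 x2 x3).

Lemma Qx3_Qdiff : Qx3 Q i1 i2 const3 x2 x3 = Qx1_poly%:P + (x3 - x1) * Qdiff.
Proof.
have -> : Qx3 Q i1 i2 const3 x2 x3 = Qx1 Q i1 i2 const3 x1 x2 - (x1 - x3) *
  Qdiff.
  exact: Qx3E.
by rewrite -Qx1E -mulNr opprB.
Qed.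

Hypothesis a_gt0 : (0 < a)%N.

(** [x3 - x1] times the divided difference is [Q(x3, x2) - Q(x1, x2)], whose
    leading term in [x3] is that of [Q(x3, x2)]. *)
Lemma size_Qdiff : (size Qdiff <= a.-1.+1)%N /\ t12^-1%:P%:P * Qdiff`_a.-1 = 1.
Proof.
have E : (x3 - x1) * Qdiff = Qx3 Q i1 i2 const3 x2 x3 - Qx1_poly%:P by rewrite
  Qx3_Qdiff [RHS]addrC addKr.
have sE : (size ((x3 - x1) * Qdiff)%R <= a.-1.+2)%N.
  rewrite E prednK // (leq_trans (size_polyD _ _)) // geq_max size_Qx3.
  by rewrite size_polyN (leq_trans (size_polyC_leq1 _)).
have [sD ->] := size_divX sE; split=> //.
rewrite E coefB prednK // Qx3_lead coefC -[_ == _]negbK -lt0n a_gt0 subr0.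
by rewrite -!rmorphM mulVf ?t12_neq0.
Qed.

Lemma size_h l : (size (hsum l.+1 x1 x3) <= l.+1)%N /\ (hsum l.+1 x1 x3)`_l = 1.
Proof.
have E : (x3 - x1) * hsum l.+1 x1 x3 = x3 ^+ l.+1 - ('X%:P ^+ l.+1)%:P.
  rewrite -opprB mulNr hsumP ?opprB; last exact: mulrC.
  by rewrite rmorphXn.
have sE : (size ((x3 - x1) * hsum l.+1 x1 x3)%R <= l.+2)%N.
  by rewrite E size_XnsubC.
have [sh ->] := size_divX sE; split=> //.
by rewrite E coefB coefXn eqxx coefC subr0.
Qed.

End Qcoefficients.

(** * Linear combinations and coefficients *)
Section Span.
Variables (R : pzRingType) (V : lmodType R) (T : eqType) (f : T -> V).

Definition in_span (v : V) := exists (s : seq T) (c : T -> R),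
  v = \sum_(t <- s) c t *: f t.

(** The scalars of a combination form a function on the index type, so two
    combinations are put together by counting multiplicities. *)
Lemma sum_count (s u : seq T) (F : T -> V) : uniq u -> {subset s <= u} ->
  \sum_(t <- s) F t = \sum_(t <- u) F t *+ count_mem t s.
Proof.
move=> uu; elim: s => [|t0 s IHs] su.
  by rewrite big_nil big1.
rewrite big_cons IHs; last by move=> t ts; apply: su; rewrite inE ts orbT.
have t0u : t0 \in u by apply: su; rewrite inE eqxx.
rewrite !(bigD1_seq t0 t0u uu) /= eqxx mulrS -addrA; congr (_ + (_ + _)).
by apply: eq_bigr => t /negPf tt0; rewrite eq_sym tt0.
Qed.

Lemma in_spanB v w : in_span v -> in_span w -> in_span (v - w).
Proof.
move=> [s [c ->]] [s' [c' ->]]; pose u := undup (s ++ s').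
exists u, (fun t => c t *+ count_mem t s - c' t *+ count_mem t s').
rewrite (sum_count (u := u)) ?undup_uniq //; last first.
  by move=> t ts; rewrite mem_undup mem_cat ts.
rewrite (sum_count (s := s') (u := u)) ?undup_uniq //; last first.
  by move=> t ts; rewrite mem_undup mem_cat ts orbT.
rewrite -sumrB; apply: eq_bigr => t _.
by rewrite scalerBl !scalerMnl.
Qed.

Lemma in_span0 : in_span 0.
Proof. by exists [::], (fun=> 0); rewrite big_nil. Qed.

Lemma in_span1 c t : in_span (c *: f t).
Proof. by exists [:: t], (fun=> c); rewrite big_seq1. Qed.

End Span.

Section Coefficients.
Variable K : fieldType.
Local Notation S := {poly {poly {poly K}}}.
Local Notation x1 := ('X%:P%:P : S).
Local Notation x2 := ('X%:P : S).
Local Notation x3 := ('X : S).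

Local Notation mon3 := (mon3 x1 x2 x3).
Definition coef3 (k : nat * nat * nat) (F : S) : K := F`_k.2`_k.1.2`_k.1.1.

Lemma coef3_mon (c : K) k k' : coef3 k' (const3 K c * mon3 k) = c * (k' ==
  k)%:R.
Proof.
have -> : const3 K c * mon3 k =
    ((c%:P * 'X^(k.1.1))%:P * 'X^(k.1.2))%:P * 'X^(k.2).
  by rewrite /mon3 /const3 /= !(rmorphM, rmorphXn) /= !mulrA.
case: k k' => [[k1 k2] k3] [[j1 j2] j3]; rewrite /coef3 /=.
rewrite coefCM coefXn !xpair_eqE /=.
case: (j3 == k3); last by rewrite andbF !mulr0 !coef0.
rewrite mulr1 coefCM coefXn andbT.
case: (j2 == k2); last by rewrite andbF !mulr0 !coef0.
by rewrite mulr1 coefCM coefXn andbT.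
Qed.

Lemma coef3_sum (T : Type) (s : seq T) (F : T -> S) k :
  coef3 k (\sum_(t <- s) F t) = \sum_(t <- s) coef3 k (F t).
Proof. by rewrite /coef3 !coef_sum. Qed.

Lemma reducedP l' n2 n3 (F : S) :
  (forall k, coef3 k F != 0 -> [&& (k.1.1 < l'.+1)%N, (k.1.2 < n2)%N & (k.2 <
    n3)%N]) ->
  reduced l' n2 n3 F.
Proof.
move=> h; split=> [|k|k j].
- apply/leq_sizeP => j3 le; apply/polyP => j2; apply/polyP => j1;
  rewrite !coef0.
  apply/eqP/negPn/negP => /(h (j1, j2, j3)) /and3P[_ _] /=.
  by rewrite ltnNge le.
- apply/leq_sizeP => j2 le; apply/polyP => j1; rewrite !coef0.
  apply/eqP/negPn/negP => /(h (j1, j2, k)) /and3P[_ ] /=.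
  by rewrite ltnNge le.
- apply/leq_sizeP => j1 le.
  apply/eqP/negPn/negP => /(h (j1, j, k)) /and3P[] /=.
  by rewrite ltnNge le.
Qed.

End Coefficients.

(** * The basis of e(121) R e(121) *)
Section Concrete.
Variables (I : choiceType) (C : cartan_datum I) (X : realization C).
Variables (K : fieldType) (Q : I -> I -> {poly {poly K}}).
Hypothesis hQ : QH_param X Q.
Variables (Lambda : wlat X) (i1 i2 : I).
Hypothesis i12 : i1 != i2.

Local Notation S := {poly {poly {poly K}}}.
Local Notation x1 := ('X%:P%:P : S).
Local Notation x2 := ('X%:P : S).
Local Notation x3 := ('X : S).
Local Notation beta := (simple_root X i1 *+ 2 + simple_root X i2).
Local Notation nu := (nu X i1 i2).
Local Notation F := (free_alg K (QH_gen 3 beta)).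
Local Notation H := (quiver_hecke Q 3 beta).
Local Notation R := (cyc_quiver_hecke Q 3 beta Lambda).
Local Notation pi := (QH_pi Q 3 beta).
Local Notation sc := (QH_scalar Q 3 beta).
Local Notation xx := (QH_x Q (n := 3) beta).
Local Notation psi := (QH_psi Q (n := 3) beta).
Local Notation e := (QH_e Q (n := 3) (beta := beta)).
Local Notation cpi := (cyc_pi Q 3 beta Lambda).
Local Notation iK := (const3 K).

Local Notation Qd := (QH_diag hQ).
Local Notation Q21 := (Q21_swap hQ i12).

Variable ev : {rmorphism S -> H}.
Hypothesis ev_sc : forall k, ev (iK k) = sc k.
Hypotheses (ev_x1 : ev x1 = xx o0) (ev_x2 : ev x2 = xx o1) (ev_x3 : ev x3 = xx
  o2).
Local Notation Theta := (Theta ev).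

Variable rho : {rmorphism F -> 'M['M[S]_2]_3}.
Hypothesis rho_c : forall c, rho c%:A = rho_scalar iK c.
Hypothesis rho_g : forall g, rho (free_gen K g) = rho_gen Q iK x1 x2 x3 g.

Local Notation mon3 := (mon3 x1 x2 x3).
Local Notation basis_vec := (basis_vec x1 x2 x3).
Local Notation basis_word := (basis_word X K i1 i2).

Variables (l' m a' b : nat).
Hypothesis l_def : `|simple_coroot X i1 Lambda|%N = l'.+1.
Hypothesis m_def : `|simple_coroot X i2 Lambda|%N = m.
Hypothesis a_def : `|cartan C i1 i2|%N = a'.+1.
Hypothesis b_def : `|cartan C i2 i1|%N = b.

Local Notation h := (hsum l'.+1 x1 x3).
Local Notation D := (Qdiff Q i1 i2 iK x1 x2 x3).
Local Notation Qq := (Qx3 Q i1 i2 iK x2 x3).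
Local Notation A := (Qx1_poly Q i1 i2).

Let sA : (size A <= b.+1)%N.
Proof. by rewrite -b_def; apply: (size_Qx1_poly hQ i12). Qed.
Let tA : (t21 C Q i1 i2)^-1%:P * A`_b = 1.
Proof. by rewrite -b_def; apply: (Qx1_poly_top hQ i12). Qed.
Let sD : (size D <= a'.+1)%N.
Proof. by have := size_Qdiff hQ i12; rewrite a_def => /(_ isT)[]. Qed.
Let tD : (t12 C Q i1 i2)^-1%:P%:P * D`_a' = 1.
Proof. by have := size_Qdiff hQ i12; rewrite a_def => /(_ isT)[]. Qed.
Let QqE : Qq = A%:P + (x3 - x1) * D.
Proof. exact: Qx3_Qdiff. Qed.
Let sh : (size h <= l'.+1)%N.
Proof. exact: (size_h K l').1. Qed.
Let th : h`_l' = 1.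
Proof. exact: (size_h K l').2. Qed.

Lemma cyc_rel121E f g : cyc_rel121 Q i1 i2 iK x1 x2 x3 l'.+1 m f g <->
  rel121 (x1 ^+ l'.+1) (x2 ^+ m) A%:P Qq D h f g.
Proof. by rewrite /cyc_rel121 Qx1E. Qed.

Definition bounded (k : bool * (nat * nat * nat)) : bool :=
  if k.1 then [&& k.2.1.1 < l'.+1, k.2.1.2 < m + b & k.2.2 < l' + a']%N
  else [&& k.2.1.1 < l'.+1, k.2.1.2 < m & k.2.2 < l'.+1]%N.

Variables (T : eqType) (code : T -> bool * (nat * nat * nat)) (f : T -> R).
Hypothesis code_inj : injective code.
Hypothesis code_bounded : forall t, bounded (code t).
Hypothesis code_surj : forall k, bounded k -> exists t, code t = k.
Hypothesis fE : forall t, f t = cpi (pi (basis_word (code t))).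

(** By [relation_rel121], the coordinates of a vanishing combination form a pair
    of [rel121]; this pair is reduced, hence zero. *)
Lemma basis_words_free : free_family f.
Proof.
move=> s c us e0.
pose G b' := \sum_(t <- s) iK (c t) * basis_vec (code t) (if b' then 0 else 1)
  0.
have Jz : cyc_rel121 Q i1 i2 iK x1 x2 x3 l'.+1 m (G true) (G false).
  apply: (relation_rel121 i12 Qd Q21 rho_c rho_g l_def m_def).
  by rewrite -[RHS]e0; apply: eq_bigr => t _; rewrite fE.
have coefE k b' : coef3 k (G b') = \sum_(t <- s) c t * ((b', k) == code t)%:R.
  rewrite /G coef3_sum; apply: eq_bigr => t _; case: (code t) => b2 k2.
  rewrite /basis_vec xpair_eqE.
  case: b' b2 => [] [] /=; rewrite mxE /= ?coef3_mon //;
    by rewrite !mulr0 /coef3 !coef0.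
have red b' : reduced l' (if b' then m + b else m)%N (if b' then l' + a' else
  l'.+1)%N (G b').
  apply: reducedP => k; rewrite coefE => ne.
  have : bounded (b', k).
    apply: contraNT ne => nb; rewrite big1 // => t _.
    have [kt|] := eqVneq (b', k) (code t); last by rewrite mulr0.
    by rewrite kt code_bounded in nb.
  by rewrite /bounded /=; case: (b').
have [F0 G0] := reduced_rel121_eq0 sA tA sD tD QqE sh th (proj1 (cyc_rel121E _
  _) Jz) (red true) (red false).
move=> t ts; case E: (code t) => [b' k].
have := coefE k b'; rewrite (bigD1_seq t) //= E eqxx mulr1 big1 ?addr0.
  by move=> <-; case: (b'); rewrite ?F0 ?G0 /coef3 !coef0.
move=> t' t't; rewrite -E (inj_eq code_inj) eq_sym (negPf t't).
by rewrite mulr0.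
Qed.

(** The pairs whose image is in the span contain the reduced monomials and, by
    [killed_rel121], the relations. *)
Lemma basis_words_span F G : in_span f (cpi (Theta o0 (cv F G))).
Proof.
pose Sp F G := in_span f (cpi (Theta o0 (cv F G))).
have hE : (x1 - x3) * h = x1 ^+ l'.+1 - x3 ^+ l'.+1 by rewrite hsumP //;
  apply: mulrC.
have mono_span c k : bounded k ->
    in_span f (cpi (c *: Theta o0 (basis_vec k))).
  by move=> /code_surj[t <-];
    rewrite cyc_piZ -(pi_basis_word ev_x1 ev_x2 ev_x3) -fE; apply: in_span1.
apply: (@generate K l' m a' b A D Qq h _ _ sA tA sD tD QqE sh th Sp) => //.
- move=> f1 g1 f2 g2 h1 h2; rewrite /Sp.
  by rewrite Theta_sub rmorphB; apply: in_spanB.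
- move=> f1 g1 /cyc_rel121E J; rewrite /Sp.
  have -> := killed_rel121 i12 Qd Q21 l_def m_def ev_sc ev_x1 ev_x2 ev_x3 J.
  exact: in_span0.
- move=> c c1 c2 c3 b1 b2 b3; rewrite /Sp.
  have := mono_span c (true, (c1, c2, c3));
    rewrite /basis_vec -(Theta_scaled ev_sc) mulr0.
  by apply; rewrite /bounded /= b1 b2 b3.
- move=> c c1 c2 c3 b1 b2 b3; rewrite /Sp.
  have := mono_span c (false, (c1, c2, c3));
    rewrite /basis_vec -(Theta_scaled ev_sc) mulr0.
  by apply; rewrite /bounded /= b1 b2 b3.
Qed.

End Concrete.

Theorem theorem5p34 (I : choiceType) (C : cartan_datum I) (X : realization C)
  (K : fieldType) (Q : I -> I -> {poly {poly K}}) (hQ : QH_param X Q)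
  (Lambda : wlat X) (hLambda : dominant Lambda)
  (i1 i2 : I) (hi : i1 != i2) (ha : cartan C i1 i2 != 0) :
  let l1 := simple_coroot X i1 Lambda in
  let l2 := simple_coroot X i2 Lambda in
  let a12 := cartan C i1 i2 in
  let a21 := cartan C i2 i1 in
  let beta := simple_root X i1 *+ 2 + simple_root X i2 in
  let R := cyc_quiver_hecke Q 3 beta Lambda in
  let psi1 : R := cyc_psi (n := 3) Q beta Lambda (@Ordinal 2 0 isT) in
  let psi2 : R := cyc_psi (n := 3) Q beta Lambda (@Ordinal 2 1 isT) in
  let x1 : R := cyc_x (n := 3) Q beta Lambda (@Ordinal 3 0 isT) in
  let x2 : R := cyc_x (n := 3) Q beta Lambda (@Ordinal 3 1 isT) in
  let x3 : R := cyc_x (n := 3) Q beta Lambda (@Ordinal 3 2 isT) in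
  let e121 : R := cyc_e Q Lambda (nu121 X i1 i2) in
  basis_family (fun y : R => exists z : R, y = e121 * z * e121)
    (fun k : {k : nat * nat * nat |
                [&& k.1.1%:Z < l1, k.1.2%:Z < l2 & k.2%:Z < l1]}
           + {k : nat * nat * nat |
                [&& k.1.1%:Z < l1, k.1.2%:Z < l2 - a21
                  & k.2%:Z < l1 - a12 - 2]} =>
       match k with
       | inl (exist (k1, k2, k3) _) =>
           psi1 * psi2 * psi1 * x1 ^+ k1 * x2 ^+ k2 * x3 ^+ k3 * e121
       | inr (exist (k1, k2, k3) _) =>
           x1 ^+ k1 * x2 ^+ k2 * x3 ^+ k3 * e121
       end).
Proof.
move=> l1 l2 a12 a21 beta R psi1 psi2 x1 x2 x3 e121.
pose xx := QH_x Q (n := 3) beta; pose psi := QH_psi Q (n := 3) beta.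
pose e := QH_e Q (n := 3) (beta := beta).
have Qd := QH_diag hQ.
have Q21 := Q21_swap hQ hi.
have [ev [ev_sc0 ev_x1 ev_x2 ev_x3]] := @poly3_universal K _ (QH_scalar Q 3
  beta)
  (xx o0) (xx o1) (xx o2) (@QH_scalar_central _ _ _ _ Q 3 beta)
  (xC X Q i1 i2 _ _) (xC X Q i1 i2 _ _) (xC X Q i1 i2 _ _).
have ev_sc k : ev (const3 K k) = QH_scalar Q 3 beta k := ev_sc0 k.
have [rho [rho_c rho_g]] := @rho_exists I C X K Q i1 i2 _ (const3 K) ('X%:P%:P)
  ('X%:P) 'X.
set f := (fun k : _ + _ => _).
have l1E : l1 = `|l1|%N%:Z by rewrite gez0_abs //; apply: hLambda.
have l2E : l2 = `|l2|%N%:Z by rewrite gez0_abs //; apply: hLambda.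
have a12E : a12 = - (`|a12|%N%:Z) by rewrite lez0_abs ?opprK //;
  apply: cartan_le0.
have a21E : a21 = - (`|a21|%N%:Z) by rewrite lez0_abs ?opprK //;
  apply: cartan_le0; rewrite eq_sym.
have a_gt0 : (0 < `|a12|)%N by rewrite absz_gt0.
pose cpi := cyc_pi Q 3 beta Lambda.
have sandwich y : exists f g, e121 * y * e121 = cpi (Theta ev o0 (cv f g)).
  have [u yu] := quot_pi_surj y; have [z uz] := quot_pi_surj u.
  exists (rho z o0 o0 0 0), (rho z o0 o0 1 0).
  have := sandwich_121 hi Qd Q21 rho_c rho_g ev_sc ev_x1 ev_x2 ev_x3 z.
  rewrite /Theta !mxE /= => <-.
  by rewrite !rmorphM yu uz.
have fE (k : _ + _) : f k = cpi (QH_pi Q 3 beta (basis_word X K i1 i2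
    (match k with inl u => (false, val u) | inr u => (true, val u) end))).
  case: k => [[[[k1 k2] k3] hk]|[[[k1 k2] k3] hk]].
    by rewrite /= /basis_word /mon_word /= !rmorphM !rmorphXn /= !mulrA.
  by rewrite /= /basis_word /mon_word /= !rmorphM !rmorphXn.
have eW k : exists z, f k = e121 * z * e121.
  have cM u v : cpi (u * v) = cpi u * cpi v by apply: rmorphM.
  exists (f k); rewrite {1}fE -(basis_word_sandwich ev_x1 ev_x2 ev_x3) !cM -fE.
  by [].
pose T := ({k : nat * nat * nat | [&& k.1.1%:Z < l1, k.1.2%:Z < l2 & k.2%:Z <
  l1]}
  + {k : nat * nat * nat | [&& k.1.1%:Z < l1, k.1.2%:Z < l2 - a21
                             & k.2%:Z < l1 - a12 - 2]})%type.
pose code (k : T) :=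
  match k with inl u => (false, val u) | inr u => (true, val u) end.
have code_inj : injective code.
  by case=> [u|u] [v|v] //= [] /val_inj ->.
(* For [l1 = 0], both index sets are empty and [e121] is one of the generators of
   the cyclotomic ideal. *)
have [l0|] := posnP `|l1|%N.
  have vac (k : T) : False.
    by case: k => -[[[k1 k2] k3]] /= /andP[]; rewrite l1E l0.
  have e0 : e121 = 0.
    have := killed_x1l hi l0 (erefl _) ev_sc ev_x1 ev_x2 ev_x3.
    by rewrite /killed Theta_one ?mxE // expr0.
  split=> [k|s c _ _ k|v [z ->]]; try by case: (vac k).
  by exists [::], (fun=> 0); rewrite big_nil e0 mulr0.
case El : `|l1|%N => [//|l'] _; case Ea : `|a12|%N a_gt0 => [//|a'] _.
have code_bounded (k : T) : bounded l' `|l2|%N a' `|a21|%N (code k).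
  move: l1E l2E a12E a21E; rewrite El Ea /bounded.
  by case: k => -[[[k1 k2] k3]] /= /and3P[? ? ?] ? ? ? ?; apply/and3P; split;
    lia.
have code_surj k : bounded l' `|l2|%N a' `|a21|%N k -> exists t, code t = k.
  case: k => [[] k]; rewrite /bounded /= => /and3P[b1 b2 b3].
    have hk : [&& k.1.1%:Z < l1, k.1.2%:Z < l2 - a21 & k.2%:Z < l1 - a12 - 2].
      by move: l1E l2E a12E a21E; rewrite El Ea => *; apply/and3P; split; lia.
    by exists (inr (exist _ k hk)).
  have hk : [&& k.1.1%:Z < l1, k.1.2%:Z < l2 & k.2%:Z < l1].
    by move: l1E l2E a12E a21E; rewrite El Ea => *; apply/and3P; split; lia.
  by exists (inl (exist _ k hk)).
split=> [//||v [z ->]].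
- exact: (basis_words_free hQ hi rho_c rho_g El (erefl _) Ea (erefl _) code_inj
  code_bounded fE).
- have [F [G ->]] := sandwich z.
  have [s [c E]] := basis_words_span hQ hi ev_sc ev_x1 ev_x2 ev_x3 El (erefl _)
    Ea (erefl _) code_surj fE F G.
  by exists s, c; rewrite -E.
Qed.
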